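(* Let $V(u,r)$ be a smooth radially symmetric potential on $\mathbb{R}\times\mathbb{R}^2$ (depending on $u$ and $r=|x|$) with $V(u,r)=0$ whenever $|u|\ge U$ or $r>R$, for some constants $U,R>0$. Let $W(u,t)=V(u,e^t)$ and $T=\ln R$ (so $W$ is supported in the semi-strip $\{|u|\le U,\ t\le T\}$), and consider the Hamiltonian system $$\dot u = p,\qquad \dot p = -e^{2t}W'_u(u,t),$$ with Hamiltonian $H=\tfrac12p^2+e^{2t}W(u,t)$. Then, unless $W$ vanishes identically, there exists a solution $(u(t),p(t))$, $t\in\mathbb{R}$, of this system having conjugate points.
   Context: A solution $u(t)$, $t\in\mathbb{R}$, has conjugate points if there exist $t_1<t_2$ and a solution $\xi\not\equiv0$ of the Jacobi (linearised) equation $\ddot\xi+e^{2t}W''_{uu}(u(t),t)\,\xi=0$ with $\xi(t_1)=\xi(t_2)=0$. (The system arises from radial solutions $u(r)$ of $\Delta u=-V'_u$ via the substitution $r=e^t$.) *)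

(* Defs.v *)
From Stdlib Require Import Reals List.
From Coquelicot Require Import Coquelicot.
Open Scope R_scope.

Definition pderiv3 (i : nat) (f : R -> R -> R -> R) : R -> R -> R -> R :=
  fun a b c =>
    match i with
    | O => Derive (fun y => f y b c) a
    | S O => Derive (fun y => f a y c) b
    | _ => Derive (fun y => f a b y) c
    end.

Definition ex_pderiv3 (i : nat) (f : R -> R -> R -> R) (a b c : R) : Prop :=
  match i with
  | O => ex_derive (fun y => f y b c) a
  | S O => ex_derive (fun y => f a y c) b
  | _ => ex_derive (fun y => f a b y) c
  end.

Definition iter_pd (l : list nat) (f : R -> R -> R -> R) : R -> R -> R -> R :=
  fold_right pderiv3 f l.

Definition smooth3 (f : R -> R -> R -> R) : Prop :=
  forall l : list nat,
    (forall a b c : R,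
        continuous (fun p : R * (R * R) =>
                      iter_pd l f (fst p) (fst (snd p)) (snd (snd p))) (a, (b, c)))
    /\ (forall i : nat, (i <= 2)%nat -> forall a b c : R, ex_pderiv3 i (iter_pd l f) a b c).

Definition radial_lift (V : R -> R -> R) : R -> R -> R -> R :=
  fun u x1 x2 => V u (sqrt (x1 ^ 2 + x2 ^ 2)).

Definition Wof (V : R -> R -> R) : R -> R -> R := fun u t => V u (exp t).

Definition W_u (W : R -> R -> R) (u t : R) : R := Derive (fun v => W v t) u.
Definition W_uu (W : R -> R -> R) (u t : R) : R :=
  Derive (fun v => W_u W v t) u.

Definition is_solution (W : R -> R -> R) (u p : R -> R) : Prop :=
  forall t : R,
    is_derive u t (p t) /\
    is_derive p t (- (exp (2 * t) * W_u W (u t) t)).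

Definition has_conjugate_points (W : R -> R -> R) (u : R -> R) : Prop :=
  exists (t1 t2 : R) (xi dxi : R -> R),
    t1 < t2 /\
    (exists t, xi t <> 0) /\
    (forall t : R,
        is_derive xi t (dxi t) /\
        is_derive dxi t (- (exp (2 * t) * W_uu W (u t) t * xi t))) /\
    xi t1 = 0 /\ xi t2 = 0.

(* Main.v *)
Require Import Defs.
From Stdlib Require Import Reals List Lra Lia Psatz Classical.
From Coquelicot Require Import Coquelicot.
Open Scope R_scope.

(** Write [F(u,s) = e^{2s} W(u,s)] and let an orbit enter the strip [|u| <= U + 1] from the left
    at time [s0] with a large speed [P]; it leaves on the right after a time [O(1/P)] and is free
    before and after.  With the energy [h = p^2/2 + F] and [zeta = 1 + (h - P^2/2) / P^2], the
    variation [p * zeta] has an index form that reduces to an integral of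
    [F_ss zeta^2 + 2 F_s^2 zeta / P^2 - p^2 F_s^2 / P^4] with the opposite sign.  If the orbit has
    no conjugate points the index form is nonnegative, and expanding in [1/P] gives
    [int Z_ss(y, s0 + (y + U + 1)/P) dy <= C e^{2 s0} / P^3], where [Z = F + F^2 / (2 P^2)].
    So the function [s |-> int Z(y, s + (y + U + 1)/P) dy], which vanishes at both ends, is concave
    up to [O(P^{-3})], hence is [O(P^{-3})] up to a polynomial factor in [s], and so is, after
    undoing the shear by integrating over [s], the integral of [F + F^2 / (2 P^2)] over the plane.
    Comparing the speeds [P] and [2 P] shows that the integral of [F^2] is zero. *)

(** Along an orbit [p] solves the Jacobi equation up to the forcing [- F_us], so its index form is
    [- int F_ss dt] plus boundary terms: this makes [p] the natural test variation. But passing from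
    [dt] to [dy / p] turns [F_ss] into [F_ss + F F_ss / P^2], up to the scale [1 / P], and this is
    no second derivative in [s]. Multiplying [p] by [1 + c eta / P^2], with [eta = h - P^2 / 2],
    supplies [(2 c - c^2) F_s^2 / P^2], since [eta' = F_s]; for [c = 1] the sum is exactly [Z_ss],
    and any other [c] would leave a multiple of [F_s^2]. The linear term [F] has no definite sign,
    so the contradiction has to come from [F^2 / P^2]; hence every error must be of order [P^(-3)].
    As [s] tends to minus infinity [F] decays only like [e^{2s}], so the argument starts at an [s]
    of order [- ln P]. The length of that window enters quadratically, a power of [ln P] that the
    gained factor [1 / P] absorbs. *)

(** * Calculus *)

Lemma is_derive_eq (f : R -> R) (x l l' : R) :
  is_derive f x l -> l = l' -> is_derive f x l'.
Proof. now intros H <-. Qed.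

Lemma is_derive_Rconst (c x : R) : is_derive (fun _ => c) x 0.
Proof. exact (is_derive_const c x). Qed.

Lemma is_derive_Rlinear (c x : R) : is_derive (fun t => c * t) x c.
Proof. auto_derive; [easy | ring]. Qed.

Lemma is_derive_Rplus (f g : R -> R) (x l m : R) :
  is_derive f x l -> is_derive g x m -> is_derive (fun t => f t + g t) x (l + m).
Proof. exact (is_derive_plus f g x l m). Qed.

Lemma is_derive_Rminus (f g : R -> R) (x l m : R) :
  is_derive f x l -> is_derive g x m -> is_derive (fun t => f t - g t) x (l - m).
Proof. exact (is_derive_minus f g x l m). Qed.

Lemma is_derive_Rmult (f g : R -> R) (x l m : R) :
  is_derive f x l -> is_derive g x m ->
  is_derive (fun t => f t * g t) x (l * g x + f x * m).
Proof. intros Hf Hg. exact (is_derive_mult f g x l m Hf Hg Rmult_comm). Qed.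

Lemma is_derive_Rdiv_const (f : R -> R) (x l c : R) :
  is_derive f x l -> is_derive (fun t => f t / c) x (l / c).
Proof. exact (is_derive_scal_l f x l (/ c)). Qed.

Lemma is_derive_Rsqr_pow (f : R -> R) (x l : R) :
  is_derive f x l -> is_derive (fun t => f t ^ 2) x (2 * f x * l).
Proof.
  intros Hf. apply is_derive_eq with (INR 2 * l * f x ^ 1).
  - exact (is_derive_pow f 2 x l Hf).
  - simpl. ring.
Qed.

Ltac derive_poly :=
  lazymatch goal with
  | |- is_derive (fun _ => ?c) _ _ => apply is_derive_Rconst
  | |- is_derive (fun t => @?f t / ?c) _ _ =>
      apply (is_derive_Rdiv_const f); derive_poly
  | |- is_derive (fun t => @?f t ^ 2) _ _ =>
      apply (is_derive_Rsqr_pow f); derive_poly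
  | |- is_derive (fun t => @?f t - @?g t) _ _ =>
      apply (is_derive_Rminus f g); derive_poly
  | |- is_derive (fun t => @?f t + @?g t) _ _ =>
      apply (is_derive_Rplus f g); derive_poly
  | |- is_derive (fun t => @?f t * @?g t) _ _ =>
      apply (is_derive_Rmult f g); derive_poly
  | |- _ => eassumption
  end.

Lemma is_derive_continuity_pt (f : R -> R) (x l : R) :
  is_derive f x l -> continuity_pt f x.
Proof.
  intros H. apply continuity_pt_filterlim, (ex_derive_continuous f x).
  now exists l.
Qed.

Lemma is_derive_locally_zero (f : R -> R) (x l : R) :
  is_derive f x l -> locally x (fun y => f y = 0) -> l = 0.
Proof.
  intros H Hloc.
  rewrite <- (is_derive_unique f x l H).
  rewrite (Derive_ext_loc f (fun _ => 0) x Hloc).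
  apply Derive_const.
Qed.

Lemma locally_gt (a x : R) : a < x -> locally x (fun y => a < y).
Proof. intros H. exact (open_gt a x H). Qed.

Lemma locally_Rabs_gt (a x : R) : a < Rabs x -> locally x (fun y => a < Rabs y).
Proof.
  intros H.
  assert (He : 0 < Rabs x - a) by lra.
  exists (mkposreal _ He). intros y Hy.
  change (Rabs (y - x) < Rabs x - a) in Hy.
  pose proof (Rabs_triang_inv x y). rewrite Rabs_minus_sym in Hy. lra.
Qed.

Lemma increment_le (f g f' g' : R -> R) (a b : R) :
  a <= b ->
  (forall t, a <= t <= b -> is_derive f t (f' t)) ->
  (forall t, a <= t <= b -> is_derive g t (g' t)) ->
  (forall t, a <= t <= b -> f' t <= g' t) ->
  f b - f a <= g b - g a.
Proof.
  intros Hab Hf Hg Hle.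
  destruct (MVT_gen (fun t => g t - f t) a b (fun t => g' t - f' t))
    as [c [Hc E]].
  - intros t. rewrite Rmin_left, Rmax_right by lra. intros Ht.
    apply (is_derive_minus g f); [apply Hg | apply Hf]; lra.
  - intros t. rewrite Rmin_left, Rmax_right by lra. intros Ht.
    apply (is_derive_continuity_pt _ _ (g' t - f' t)).
    apply (is_derive_minus g f); [apply Hg | apply Hf]; lra.
  - rewrite Rmin_left, Rmax_right in Hc by lra.
    specialize (Hle c Hc).
    assert (0 <= (g' c - f' c) * (b - a)) by (apply Rmult_le_pos; lra).
    lra.
Qed.

Lemma increment_abs_le (f g f' g' : R -> R) (a b : R) :
  a <= b ->
  (forall t, a <= t <= b -> is_derive f t (f' t)) ->
  (forall t, a <= t <= b -> is_derive g t (g' t)) ->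
  (forall t, a <= t <= b -> Rabs (f' t) <= g' t) ->
  Rabs (f b - f a) <= g b - g a.
Proof.
  intros Hab Hf Hg Hle.
  apply Rabs_le. split.
  - assert (- f b - - f a <= g b - g a).
    { apply (increment_le (fun t => - f t) g (fun t => - f' t) g'); auto.
      - intros t Ht. apply (is_derive_opp f). auto.
      - intros t Ht. specialize (Hle t Ht). apply Rabs_le_between in Hle. lra. }
    lra.
  - apply (increment_le f g f' g'); auto.
    intros t Ht. specialize (Hle t Ht). apply Rabs_le_between in Hle. lra.
Qed.

Lemma increment_abs_le_linear (f f' : R -> R) (a b M : R) :
  a <= b ->
  (forall t, a <= t <= b -> is_derive f t (f' t)) ->
  (forall t, a <= t <= b -> Rabs (f' t) <= M) ->
  Rabs (f b - f a) <= M * (b - a).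
Proof.
  intros Hab Hf Hle.
  replace (M * (b - a)) with (M * b - M * a) by ring.
  apply (increment_abs_le f (fun t => M * t) f' (fun _ => M)); auto.
  intros t _. apply is_derive_Rlinear.
Qed.

(** The half-line below [Rmax a b] is the natural domain for derivative bounds that grow like
    [exp (2 * s)]. *)
Lemma increment_abs_le_dist (f f' : R -> R) (a b M : R) :
  (forall t, is_derive f t (f' t)) ->
  (forall t, t <= Rmax a b -> Rabs (f' t) <= M) ->
  Rabs (f b - f a) <= M * Rabs (b - a).
Proof.
  intros Hf Hle. destruct (Rle_lt_dec a b) as [H | H].
  - rewrite (Rabs_pos_eq (b - a)) by lra.
    apply (increment_abs_le_linear f f'); auto.
    intros t Ht. apply Hle. rewrite Rmax_right; lra.
  - rewrite Rabs_minus_sym, (Rabs_minus_sym b), (Rabs_pos_eq (a - b)) by lra.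
    apply (increment_abs_le_linear f f'); auto; [lra |].
    intros t Ht. apply Hle. rewrite Rmax_left; lra.
Qed.

Lemma derive_zero_increment (f : R -> R) (a b : R) :
  a <= b -> (forall t, a <= t <= b -> is_derive f t 0) -> f b = f a.
Proof.
  intros Hab Hf.
  assert (H : Rabs (f b - f a) <= 0 * (b - a)).
  { apply (increment_abs_le_linear f (fun _ => 0)); auto.
    intros. rewrite Rabs_R0. lra. }
  rewrite Rmult_0_l in H.
  destruct (Req_dec (f b - f a) 0) as [E | E]; [lra |].
  apply Rabs_pos_lt in E. lra.
Qed.

(** * Jointly continuous functions of two variables *)

Definition jcont (f : R -> R -> R) : Prop := forall x y, continuity_2d_pt f x y.

Lemma jcont_continuous (f : R -> R -> R) (x y : R) :
  jcont f -> continuous (fun z : R * R => f (fst z) (snd z)) (x, y).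
Proof. intros H. apply continuity_2d_pt_filterlim, H. Qed.

Lemma continuous_jcont_comp (f : R -> R -> R) (u v : R -> R) (t : R) :
  jcont f -> continuous u t -> continuous v t ->
  continuous (fun s => f (u s) (v s)) t.
Proof.
  intros Hf Hu Hv. apply (continuous_comp_2 u v f); auto.
  now apply jcont_continuous.
Qed.

Lemma jcont_comp (f g h : R -> R -> R) :
  jcont f -> jcont g -> jcont h -> jcont (fun x y => f (g x y) (h x y)).
Proof.
  intros Hf Hg Hh x y. apply continuity_2d_pt_filterlim.
  apply (continuous_comp_2 (fun z : R * R => g (fst z) (snd z))
           (fun z : R * R => h (fst z) (snd z)) f).
  - now apply jcont_continuous.
  - now apply jcont_continuous.
  - now apply jcont_continuous.
Qed.

Lemma jcont_fst : jcont (fun x _ => x).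
Proof. intros x y. apply continuity_2d_pt_id1. Qed.

Lemma jcont_snd : jcont (fun _ y => y).
Proof. intros x y. apply continuity_2d_pt_id2. Qed.

Lemma jcont_const (c : R) : jcont (fun _ _ => c).
Proof. intros x y. apply continuity_2d_pt_const. Qed.

Lemma jcont_plus (f g : R -> R -> R) :
  jcont f -> jcont g -> jcont (fun x y => f x y + g x y).
Proof. intros Hf Hg x y. now apply continuity_2d_pt_plus. Qed.

Lemma jcont_mult (f g : R -> R -> R) :
  jcont f -> jcont g -> jcont (fun x y => f x y * g x y).
Proof. intros Hf Hg x y. now apply continuity_2d_pt_mult. Qed.

Lemma jcont_comp_1 (f : R -> R) (g : R -> R -> R) :
  (forall x, continuous f x) -> jcont g -> jcont (fun x y => f (g x y)).
Proof.
  intros Hf Hg x y. apply continuity_1d_2d_pt_comp; [| apply Hg].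
  apply continuity_pt_filterlim, Hf.
Qed.

Lemma is_derive_along (f fx fy : R -> R -> R) (u v : R -> R) (t du dv : R) :
  (forall x y, is_derive (fun z => f z y) x (fx x y)) ->
  (forall x y, is_derive (f x) y (fy x y)) ->
  jcont fx ->
  is_derive u t du -> is_derive v t dv ->
  is_derive (fun s => f (u s) (v s)) t (fx (u t) (v t) * du + fy (u t) (v t) * dv).
Proof.
  intros Hx Hy Hc Hu Hv.
  apply is_derive_Reals.
  apply derivable_pt_lim_comp_2d; try now apply is_derive_Reals.
  apply filterdiff_differentiable_pt_lim.
  refine (is_derive_filterdiff f (u t) (v t) fx (fy (u t) (v t)) _ _ _).
  - exists (mkposreal 1 Rlt_0_1). intros z _. apply Hx.
  - apply Hy.
  - now apply jcont_continuous.
Qed.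

(** A walk of [n] steps, each changing [g] by at most 1; this turns uniform continuity into
    boundedness. *)
Lemma bounded_by_steps (g : R -> R) (a d : R) (n : nat) :
  0 < d -> (forall x y, a <= x <= a + INR n * d -> a <= y <= a + INR n * d ->
    Rabs (y - x) <= d -> Rabs (g y - g x) <= 1) ->
  forall x, a <= x <= a + INR n * d -> Rabs (g x - g a) <= INR n.
Proof.
  intros Hd. induction n as [| n IH]; intros Hg x Hx.
  - simpl in Hx. replace x with a by lra.
    rewrite Rminus_diag, Rabs_R0. simpl. lra.
  - rewrite S_INR in *. pose proof (pos_INR n).
    assert (0 <= INR n * d) by (apply Rmult_le_pos; lra).
    destruct (Rle_lt_dec x (a + INR n * d)) as [Hle | Hlt].
    + assert (Rabs (g x - g a) <= INR n).
      { apply IH; [| lra]. intros; apply Hg; lra. }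
      lra.
    + assert (Rabs (g (a + INR n * d) - g a) <= INR n).
      { apply IH; [| lra]. intros; apply Hg; lra. }
      assert (Rabs (g x - g (a + INR n * d)) <= 1).
      { apply Hg; try lra. rewrite Rabs_pos_eq; lra. }
      replace (g x - g a)
        with ((g x - g (a + INR n * d)) + (g (a + INR n * d) - g a)) by ring.
      eapply Rle_trans; [apply Rabs_triang | lra].
Qed.

Lemma jcont_bounded (f : R -> R -> R) (a b c d : R) :
  jcont f ->
  exists M, 0 <= M /\ forall x y, a <= x <= b -> c <= y <= d -> Rabs (f x y) <= M.
Proof.
  intros Hf.
  destruct (uniform_continuity_2d f a b c d (fun x y _ _ => Hf x y)
              (mkposreal 1 Rlt_0_1)) as [[dl Hdl] H]; simpl in H.
  set (e := dl / 2). assert (He : 0 < e) by (unfold e; lra).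
  assert (Hn : forall l, exists n, l <= INR n * e).
  { intros l. destruct (nfloor_ex (Rmax 0 (l / e))) as [n [_ Hn]];
      [apply Rmax_l |].
    exists (S n). rewrite S_INR. pose proof (Rmax_r 0 (l / e)).
    apply Rle_trans with (l / e * e); [right; field; lra |].
    apply Rmult_le_compat_r; lra. }
  destruct (Hn (b - a)) as [n1 H1]. destruct (Hn (d - c)) as [n2 H2].
  exists (Rabs (f a c) + INR n1 + INR n2). split.
  { pose proof (Rabs_pos (f a c)). pose proof (pos_INR n1). pose proof (pos_INR n2). lra. }
  intros x y Hx Hy.
  (* A whole number of steps [e] may overshoot the rectangle, so [f] is composed with the
     1-Lipschitz clamp [Rmin z hi]. *)
  assert (Hmin : forall z lo hi, lo <= hi -> lo <= z -> lo <= Rmin z hi <= hi).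
  { intros z lo hi Hl Hz. unfold Rmin. destruct (Rle_dec z hi); lra. }
  assert (Hlip : forall z z' hi, Rabs (Rmin z' hi - Rmin z hi) <= Rabs (z' - z)).
  { intros z z' hi. unfold Rmin.
    destruct (Rle_dec z hi), (Rle_dec z' hi); try lra;
      rewrite ?Rminus_diag, ?Rabs_R0; try apply Rabs_pos;
      unfold Rabs; destruct (Rcase_abs _), (Rcase_abs _); lra. }
  assert (E1 : Rabs (f x c - f a c) <= INR n1).
  { pose proof (bounded_by_steps (fun z => f (Rmin z b) c) a e n1 He) as B.
    simpl in B. rewrite (Rmin_left a b) in B by lra.
    rewrite <- (Rmin_left x b) by lra. apply B; [| lra].
    intros z z' Hz Hz' Hzz. left. apply H; try lra; try (apply Hmin; lra).
    - eapply Rle_lt_trans; [apply Hlip | unfold e in Hzz; lra].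
    - rewrite Rminus_diag, Rabs_R0. lra. }
  assert (E2 : Rabs (f x y - f x c) <= INR n2).
  { pose proof (bounded_by_steps (fun z => f x (Rmin z d)) c e n2 He) as B.
    simpl in B. rewrite (Rmin_left c d) in B by lra.
    rewrite <- (Rmin_left y d) by lra. apply B; [| lra].
    intros z z' Hz Hz' Hzz. left. apply H; try lra; try (apply Hmin; lra).
    - rewrite Rminus_diag, Rabs_R0. lra.
    - eapply Rle_lt_trans; [apply Hlip | unfold e in Hzz; lra]. }
  replace (f x y) with (f a c + (f x c - f a c) + (f x y - f x c)) by ring.
  eapply Rle_trans; [apply Rabs_triang |].
  apply Rplus_le_compat; [| exact E2].
  eapply Rle_trans; [apply Rabs_triang |].
  apply Rplus_le_compat_l. exact E1.
Qed.

Lemma ex_RInt_cont (f : R -> R) (a b : R) :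
  (forall x, continuous f x) -> ex_RInt f a b.
Proof. intros H. apply (ex_RInt_continuous f). auto. Qed.

Lemma is_derive_RInt_upper (f : R -> R) (a x : R) :
  (forall x, continuous f x) -> is_derive (fun t => RInt f a t) x (f x).
Proof.
  intros H. apply (is_derive_RInt f (fun t => RInt f a t) a x); [| apply H].
  exists (mkposreal 1 Rlt_0_1). intros y _.
  apply (RInt_correct f). now apply ex_RInt_cont.
Qed.

Lemma is_derive_RInt_parameter (f fs : R -> R -> R) (a b s : R) :
  (forall y s, is_derive (fun s => f y s) s (fs y s)) ->
  (forall s y, continuous (fun y => f y s) y) -> jcont fs ->
  is_derive (fun s => RInt (fun y => f y s) a b) s (RInt (fun y => fs y s) a b).
Proof.
  intros Hd Hc Hj.
  assert (E : forall s y, Derive (fun s => f y s) s = fs y s)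
    by (intros; now apply is_derive_unique).
  rewrite <- (RInt_ext (fun y => Derive (fun s => f y s) s)) by auto.
  apply (is_derive_RInt_param (fun s y => f y s)).
  - exists (mkposreal 1 Rlt_0_1). intros s' _ y _. eexists; apply Hd.
  - intros y _. apply (continuity_2d_pt_ext (fun u v => fs v u)); [auto |].
    apply (jcont_comp fs (fun _ y => y) (fun x _ => x) Hj jcont_snd jcont_fst).
  - exists (mkposreal 1 Rlt_0_1). intros s' _. now apply ex_RInt_cont.
Qed.

Lemma RInt_zero (f : R -> R) (a b : R) :
  (forall x, Rmin a b < x < Rmax a b -> f x = 0) -> RInt f a b = 0.
Proof.
  intros H. rewrite (RInt_ext f (fun _ => 0)) by auto.
  rewrite RInt_const. apply Rmult_0_r.
Qed.

(** The primitive of [f] is monotone and equals 0 at both ends, so it vanishes in between, and [f]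
    is its derivative. *)
Lemma RInt_zero_nonneg (f : R -> R) (a b : R) :
  (forall x, continuous f x) -> (forall x, 0 <= f x) ->
  RInt f a b = 0 -> forall x, a < x < b -> f x = 0.
Proof.
  intros Hc Hpos H0 x Hx.
  assert (Hinc : forall s t, s <= t -> RInt f a s <= RInt f a t).
  { intros s t Hst.
    cut (0 - 0 <= RInt f a t - RInt f a s); [lra |].
    apply (increment_le (fun _ => 0) (fun t => RInt f a t) (fun _ => 0) f); auto.
    - intros; apply (is_derive_const 0).
    - intros; now apply is_derive_RInt_upper. }
  apply (is_derive_locally_zero _ x _ (is_derive_RInt_upper f a x Hc)).
  apply (filter_imp (fun y => a < y /\ y < b)).
  - intros y Hy. apply Rle_antisym.
    + rewrite <- H0. apply Hinc; lra.
    + pose proof (RInt_point a f : RInt f a a = 0) as E0.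
      rewrite <- E0. apply Hinc; lra.
  - apply filter_and; [now apply locally_gt | now apply (open_lt b)].
Qed.

Lemma exp_le_compat (x y : R) : x <= y -> exp x <= exp y.
Proof. intros [H | ->]; [left; now apply exp_increasing | apply Rle_refl]. Qed.

Lemma is_derive_shift (f f' : R -> R) (c s : R) :
  (forall s, is_derive f s (f' s)) -> is_derive (fun s => f (s + c)) s (f' (s + c)).
Proof.
  intros H. apply is_derive_eq with (1 * f' (s + c)); [| ring].
  apply (is_derive_comp f (fun s => s + c)); [apply H |].
  auto_derive; [easy | ring].
Qed.

(** Continuity is obtained from differentiability under the integral sign, whence the derivatives
    [gy] and [db]. *)
Lemma continuous_RInt_parameter (g gy : R -> R -> R) (b db a y : R) (be : R -> R) :
  (forall y s, is_derive (fun y => g y s) y (gy y s)) -> jcont g -> jcont gy ->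
  is_derive be y db ->
  continuous (fun y => RInt (g y) a (be y)) y.
Proof.
  intros Hd Hg Hgy Hb.
  assert (E : forall y s, Derive (fun z => g z s) y = gy y s)
    by (intros; now apply is_derive_unique).
  assert (Hc : forall y s, continuous (g y) s).
  { intros x s. apply (continuous_jcont_comp g (fun _ => x) (fun s => s)); auto.
    - apply continuous_const.
    - apply continuous_id. }
  assert (HD : forall x s, continuity_2d_pt (fun u v => Derive (fun z => g z v) u) x s).
  { intros x s. apply (continuity_2d_pt_ext gy); auto. }
  apply (ex_derive_continuous (fun y => RInt (g y) a (be y))). eexists.
  apply (is_derive_RInt_param_bound_comp_aux3 g a be y db); auto.
  - exists (mkposreal 1 Rlt_0_1). intros x _. now apply ex_RInt_cont.
  - exists (mkposreal 1 Rlt_0_1), (mkposreal 1 Rlt_0_1). intros x _. now apply ex_RInt_cont.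
  - exists (mkposreal 1 Rlt_0_1), (mkposreal 1 Rlt_0_1). intros x _ s _. eexists. apply Hd.
  - exists (mkposreal 1 Rlt_0_1). intros. apply HD.
  - apply continuity_pt_filterlim, Hc.
Qed.

Lemma RInt_Rminus (f g : R -> R) (a b : R) :
  (forall x, continuous f x) -> (forall x, continuous g x) ->
  RInt (fun x => f x - g x) a b = RInt f a b - RInt g a b.
Proof. intros Hf Hg. apply (RInt_minus f g); now apply ex_RInt_cont. Qed.

Lemma RInt_Rscal (c : R) (f : R -> R) (a b : R) :
  (forall x, continuous f x) -> RInt (fun x => c * f x) a b = c * RInt f a b.
Proof. intros Hf. apply (RInt_scal f). now apply ex_RInt_cont. Qed.

Lemma RInt_Rext (f g : R -> R) (a b : R) :
  (forall x, f x = g x) -> RInt f a b = RInt g a b.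
Proof. intros H. apply RInt_ext. auto. Qed.

(** * Second-order equations *)

Lemma pow_half_small (c e : R) : 0 < e -> exists n, c * (1 / 2) ^ n < e.
Proof.
  intros He.
  destruct (pow_lt_1_zero (1 / 2)) with (y := e / (Rabs c + 1)) as [N HN].
  - rewrite Rabs_pos_eq; lra.
  - pose proof (Rabs_pos c). apply Rdiv_lt_0_compat; lra.
  - exists N. specialize (HN N (le_n _)).
    pose proof (Rabs_pos c). pose proof (Rle_abs c).
    assert (Hp : 0 < (1 / 2) ^ N) by (apply pow_lt; lra).
    rewrite Rabs_pos_eq in HN by lra.
    apply Rle_lt_trans with ((Rabs c + 1) * (1 / 2) ^ N).
    + apply Rmult_le_compat_r; lra.
    + replace e with ((Rabs c + 1) * (e / (Rabs c + 1))) by (field; lra).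
      apply Rmult_lt_compat_l; lra.
Qed.

Lemma small_multiples_zero (x c : R) : (forall n, Rabs x <= c * (1 / 2) ^ n) -> x = 0.
Proof.
  intros H. destruct (Req_dec x 0) as [| Hx]; [easy | exfalso].
  destruct (pow_half_small c (Rabs x)) as [n Hn]; [now apply Rabs_pos_lt |].
  specialize (H n). lra.
Qed.

Lemma geometric_limit (x : nat -> R) (c : R) :
  (forall n, Rabs (x (S n) - x n) <= c * (1 / 2) ^ n) ->
  forall n, Rabs (real (Lim_seq x) - x n) <= 2 * c * (1 / 2) ^ n.
Proof.
  intros H.
  assert (Hc : 0 <= c).
  { specialize (H O). pose proof (Rabs_pos (x 1%nat - x O)). simpl in H. lra. }
  assert (Hp : forall n, 0 < (1 / 2) ^ n) by (intros; apply pow_lt; lra).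
  assert (Hnm : forall n m, Rabs (x (n + m)%nat - x n)
                            <= 2 * c * (1 / 2) ^ n * (1 - (1 / 2) ^ m)).
  { intros n m. induction m as [| m IH].
    - rewrite Nat.add_0_r, Rminus_diag, Rabs_R0. simpl. lra.
    - rewrite Nat.add_succ_r. specialize (H (n + m)%nat).
      rewrite pow_add in H.
      replace (x (S (n + m)) - x n)
        with ((x (S (n + m)) - x (n + m)%nat) + (x (n + m)%nat - x n)) by ring.
      eapply Rle_trans; [apply Rabs_triang |].
      simpl ((1 / 2) ^ S m). lra. }
  assert (Hnm' : forall n m, (n <= m)%nat -> Rabs (x m - x n) <= 2 * c * (1 / 2) ^ n).
  { intros n m Hle. replace m with (n + (m - n))%nat by lia.
    eapply Rle_trans; [apply Hnm |].
    pose proof (Hp (m - n)%nat). pose proof (Hp n).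
    assert (0 <= c * (1 / 2) ^ n) by (apply Rmult_le_pos; lra).
    nra. }
  assert (Hcv : ex_finite_lim_seq x).
  { apply ex_lim_seq_cauchy_corr. intros e.
    destruct (pow_half_small (4 * c) e (cond_pos e)) as [N HN].
    exists N. intros n m Hn Hm.
    replace (x n - x m) with ((x n - x N) - (x m - x N)) by ring.
    eapply Rle_lt_trans; [apply Rabs_triang |]. rewrite Rabs_Ropp.
    pose proof (Hnm' N n Hn). pose proof (Hnm' N m Hm). lra. }
  intros n. apply Lim_seq_correct' in Hcv.
  assert (Hl : is_lim_seq (fun m => Rabs (x m - x n)) (Rabs (Lim_seq x - x n))).
  { apply (is_lim_seq_abs _ (Finite (Lim_seq x - x n))).
    apply is_lim_seq_minus'; [exact Hcv | apply is_lim_seq_const]. }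
  refine (is_lim_seq_le_loc _ _ (Finite _) (Finite _) _ Hl
            (is_lim_seq_const (2 * c * (1 / 2) ^ n))).
  exists n. intros m Hm. now apply Hnm'.
Qed.

(** * Global solutions by Picard iteration *)

Section Picard.

Context (g : R -> R -> R) (La G t0 u0 p0 : R).
Context (g_cont : jcont g) (La_nonneg : 0 <= La)
  (g_lip : forall x y t, Rabs (g x t - g y t) <= La * Rabs (x - y)).

Let line (t : R) : R := u0 + p0 * (t - t0).

Context (g_line : forall t, Rabs (g (line t) t) <= G)
  (g_line_past : forall t, t <= t0 -> g (line t) t = 0).

Let force (v : R -> R) (t : R) : R := g (v t) t.
Let mom (v : R -> R) (t : R) : R := p0 - RInt (force v) t0 t.
Let pos (v : R -> R) (t : R) : R := u0 + RInt (mom v) t0 t.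

Let force_cont (v : R -> R) :
  (forall t, continuous v t) -> forall t, continuous (force v) t.
Proof.
  intros Hv t. apply (continuous_jcont_comp g v (fun t => t)); auto.
  apply continuous_id.
Qed.

Let mom_derive (v : R -> R) :
  (forall t, continuous v t) -> forall t, is_derive (mom v) t (- g (v t) t).
Proof.
  intros Hv t. unfold mom.
  apply is_derive_eq with (0 - force v t); [| unfold force; ring].
  apply (is_derive_minus (fun _ => p0)); [apply (is_derive_const p0) |].
  now apply is_derive_RInt_upper, force_cont.
Qed.

Let mom_cont (v : R -> R) :
  (forall t, continuous v t) -> forall t, continuous (mom v) t.
Proof.
  intros Hv t. apply (ex_derive_continuous (mom v)).
  eexists. now apply mom_derive.
Qed.

Let pos_derive (v : R -> R) :
  (forall t, continuous v t) -> forall t, is_derive (pos v) t (mom v t).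
Proof.
  intros Hv t. unfold pos.
  apply is_derive_eq with (0 + mom v t); [| ring].
  apply (is_derive_plus (fun _ => u0)); [apply (is_derive_const u0) |].
  now apply is_derive_RInt_upper, mom_cont.
Qed.

Let pos_cont (v : R -> R) :
  (forall t, continuous v t) -> forall t, continuous (pos v) t.
Proof.
  intros Hv t. apply (ex_derive_continuous (pos v)).
  eexists. now apply pos_derive.
Qed.

Let mom_start (v : R -> R) : mom v t0 = p0.
Proof.
  unfold mom. pose proof (RInt_point t0 (force v) : RInt (force v) t0 t0 = 0). lra.
Qed.

Let pos_start (v : R -> R) : pos v t0 = u0.
Proof.
  unfold pos. pose proof (RInt_point t0 (mom v) : RInt (mom v) t0 t0 = 0). lra.
Qed.

(** No force acts along the incoming line, so every iterate keeps it before [t0] and contraction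
    matters only for [t >= t0]. *)
Let pos_past (v : R -> R) :
  (forall t, t <= t0 -> v t = line t) -> forall t, t <= t0 -> pos v t = line t.
Proof.
  intros Hv t Ht. unfold pos, line.
  rewrite (RInt_ext (mom v) (fun _ => p0)).
  - rewrite RInt_const. change (scal (t - t0) p0) with ((t - t0) * p0). ring.
  - rewrite Rmin_right, Rmax_left by lra. intros s Hs. unfold mom.
    rewrite RInt_zero; [apply Rminus_0_r |].
    rewrite Rmin_right, Rmax_left by lra. intros r Hr. unfold force.
    rewrite Hv by lra. apply g_line_past. lra.
Qed.

(* The weight [exp (k (t - t0))] with [La / k ^ 2 <= 1 / 2] makes the Picard
   operator a contraction on the whole half-line. *)
Let k : R := 1 + 2 * La.
Let wt (t : R) : R := exp (k * (t - t0)).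

Let wt_derive (t : R) : is_derive wt t (k * wt t).
Proof. unfold wt. auto_derive; [easy | unfold Rminus; ring]. Qed.

(** Each integration gains a factor [1 / k] in the weighted norm; position is two integrations away
    from the force. *)
Let wt_increment (f f' : R -> R) (A : R) :
  0 <= A ->
  f t0 = 0 -> (forall t, is_derive f t (f' t)) ->
  (forall t, t0 <= t -> Rabs (f' t) <= A * wt t) ->
  forall t, t0 <= t -> Rabs (f t) <= A / k * wt t.
Proof.
  intros HA Hf0 Hf Hb t Ht.
  assert (Hk : 0 < k) by (unfold k; lra).
  assert (Rabs (f t - f t0) <= A / k * wt t - A / k * wt t0).
  { apply (increment_abs_le f (fun t => A / k * wt t) f' (fun t => A * wt t)); auto.
    - intros s _. apply is_derive_eq with (A / k * (k * wt s)); [| field; lra].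
      apply (is_derive_scal wt), wt_derive.
    - intros s Hs. apply Hb. lra. }
  assert (0 <= A / k * wt t0).
  { apply Rmult_le_pos; [apply Rdiv_le_0_compat; lra |].
    unfold wt. left. apply exp_pos. }
  rewrite Hf0, Rminus_0_r in H. lra.
Qed.

Let pos_contraction (v w : R -> R) (A : R) :
  0 <= A ->
  (forall t, continuous v t) -> (forall t, continuous w t) ->
  (forall t, t0 <= t -> Rabs (v t - w t) <= A * wt t) ->
  forall t, t0 <= t -> Rabs (pos v t - pos w t) <= A / 2 * wt t.
Proof.
  intros HA Hv Hw H t Ht.
  assert (Hk : 0 < k) by (unfold k; lra).
  assert (Hm : forall t, t0 <= t -> Rabs (mom v t - mom w t) <= La * A / k * wt t).
  { apply (wt_increment (fun t => mom v t - mom w t)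
             (fun t => - g (v t) t - - g (w t) t)).
    - now apply Rmult_le_pos.
    - rewrite !mom_start. ring.
    - intros s. now apply (is_derive_minus (mom v)); apply mom_derive.
    - intros s Hs. replace (- g (v s) s - - g (w s) s)
        with (- (g (v s) s - g (w s) s)) by ring.
      rewrite Rabs_Ropp. eapply Rle_trans; [apply g_lip |].
      rewrite Rmult_assoc. apply Rmult_le_compat_l; auto. }
  apply Rle_trans with (La * A / k / k * wt t).
  - apply (wt_increment (fun t => pos v t - pos w t) (fun t => mom v t - mom w t)); auto.
    + apply Rdiv_le_0_compat; [now apply Rmult_le_pos | easy].
    + rewrite !pos_start. ring.
    + intros s. now apply (is_derive_minus (pos v)); apply pos_derive.
  - apply Rmult_le_compat_r; [left; apply exp_pos |].
    apply Rmult_le_reg_r with (k * k); [nra |].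
    replace (La * A / k / k * (k * k)) with (A * La) by (field; lra).
    replace (A / 2 * (k * k)) with (A * (k * k / 2)) by field.
    apply Rmult_le_compat_l; [easy |]. unfold k. nra.
Qed.

Let iterate (n : nat) : R -> R := Nat.iter n pos line.

Let iterate_cont (n : nat) : forall t, continuous (iterate n) t.
Proof.
  induction n as [| n IH].
  - intros t. apply (ex_derive_continuous (iterate 0)).
    simpl. unfold line. auto_derive. easy.
  - intros t. simpl. now apply pos_cont.
Qed.

Let iterate_past (n : nat) : forall t, t <= t0 -> iterate n t = line t.
Proof. induction n as [| n IH]; [easy |]. simpl. now apply pos_past. Qed.

Let G_nonneg : 0 <= G.
Proof. eapply Rle_trans; [apply Rabs_pos | apply (g_line t0)]. Qed.

Let iterate_first (t : R) : t0 <= t -> Rabs (iterate 1 t - iterate 0 t) <= G * wt t.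
Proof.
  intros Ht.
  assert (Hk : 1 <= k) by (unfold k; lra).
  assert (Hw : forall s, 0 < wt s) by (intros; apply exp_pos).
  assert (Hw1 : forall s, t0 <= s -> 1 <= wt s).
  { intros s Hs. unfold wt. rewrite <- exp_0. apply exp_le_compat.
    apply Rmult_le_pos; lra. }
  assert (Hdiv : forall A, 0 <= A -> A / k <= A).
  { intros A HA. apply Rmult_le_reg_r with k; [lra |].
    unfold Rdiv. rewrite Rmult_assoc, Rinv_l by lra. nra. }
  pose proof (iterate_cont 0) as Hc.
  assert (Hm : forall s, t0 <= s -> Rabs (mom line s - p0) <= G / k * wt s).
  { apply (wt_increment (fun s => mom line s - p0) (fun s => - g (line s) s)); auto.
    - rewrite mom_start. ring.
    - intros s. apply is_derive_eq with (- g (line s) s - 0); [| ring].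
      apply (is_derive_minus (mom line)); [now apply mom_derive | apply (is_derive_const p0)].
    - intros s Hs. rewrite Rabs_Ropp. specialize (g_line s). specialize (Hw1 s Hs).
      nra. }
  apply Rle_trans with (G / k / k * wt t).
  - apply (wt_increment (fun s => pos line s - line s) (fun s => mom line s - p0)); auto.
    + apply Rdiv_le_0_compat; lra.
    + rewrite pos_start. unfold line. ring.
    + intros s. apply (is_derive_minus (pos line)); [now apply pos_derive |].
      unfold line. auto_derive; [easy | ring].
  - apply Rmult_le_compat_r; [now left |].
    eapply Rle_trans; [apply Hdiv |]; auto. apply Rdiv_le_0_compat; lra.
Qed.

Let iterate_step (n : nat) (t : R) :
  Rabs (iterate (S n) t - iterate n t) <= G * wt t * (1 / 2) ^ n.
Proof.
  destruct (Rle_lt_dec t t0) as [Ht | Ht].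
  - rewrite !iterate_past, Rminus_diag, Rabs_R0 by easy.
    apply Rmult_le_pos; [apply Rmult_le_pos |]; auto.
    + left; apply exp_pos.
    + apply pow_le; lra.
  - apply Rle_trans with (G * (1 / 2) ^ n * wt t); [| right; ring].
    apply Rlt_le in Ht. revert t Ht.
    induction n as [| n IH]; intros t Ht.
    + simpl ((1 / 2) ^ 0). rewrite Rmult_1_r. now apply iterate_first.
    + eapply Rle_trans.
      * apply (pos_contraction (iterate (S n)) (iterate n) (G * (1 / 2) ^ n)); auto.
        apply Rmult_le_pos; auto. apply pow_le; lra.
      * right. simpl. field.
Qed.

Lemma picard :
  exists u p : R -> R,
    u t0 = u0 /\ p t0 = p0 /\
    (forall t, is_derive u t (p t) /\ is_derive p t (- g (u t) t)) /\
    (forall t, t <= t0 -> u t = u0 + p0 * (t - t0)).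
Proof.
  set (u := fun t => real (Lim_seq (fun n => iterate n t))).
  assert (Hlim : forall t n, Rabs (u t - iterate n t) <= 2 * (G * wt t) * (1 / 2) ^ n).
  { intros t. apply (geometric_limit (fun n => iterate n t)).
    intros n. apply iterate_step. }
  assert (Hhalf : forall n, 0 < (1 / 2) ^ n) by (intros; apply pow_lt; lra).
  assert (Hc : forall t, continuous u t).
  { intros t. apply continuity_pt_filterlim. intros e He.
    (* The weight increases, so its value at [t + 1] makes the convergence uniform on the unit
       neighbourhood of [t]. *)
    destruct (pow_half_small (2 * (G * wt (t + 1))) (e / 3)) as [n Hn]; [lra |].
    assert (Hcn : continuity_pt (iterate n) t) by apply continuity_pt_filterlim, iterate_cont.
    destruct (Hcn (e / 3)) as [d [Hd Hdn]]; [lra |].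
    exists (Rmin d 1). split; [apply Rmin_glb_lt; lra |].
    intros s [Hs1 Hs2]. specialize (Hdn s). simpl in *. unfold Rdist in *.
    assert (Hnear : forall r, Rabs (r - t) < 1 -> Rabs (u r - iterate n r) < e / 3).
    { intros r Hr. eapply Rle_lt_trans; [apply Hlim |]. eapply Rle_lt_trans; [| exact Hn].
      apply Rmult_le_compat_r; [now left |]. apply Rmult_le_compat_l; [lra |].
      apply Rmult_le_compat_l; [easy |]. unfold wt. apply exp_le_compat.
      apply Rmult_le_compat_l; [unfold k; lra |].
      apply Rabs_lt_between in Hr. lra. }
    assert (H1 : Rabs (u s - iterate n s) < e / 3)
      by (apply Hnear; eapply Rlt_le_trans; [exact Hs2 | apply Rmin_r]).
    assert (H2 : Rabs (u t - iterate n t) < e / 3)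
      by (apply Hnear; rewrite Rminus_diag, Rabs_R0; lra).
    assert (H3 : Rabs (iterate n s - iterate n t) < e / 3).
    { apply Hdn. split; [easy |]. eapply Rlt_le_trans; [exact Hs2 | apply Rmin_l]. }
    apply Rabs_lt_between in H1. apply Rabs_lt_between in H2. apply Rabs_lt_between in H3.
    apply Rabs_lt_between. lra. }
  assert (Hpast : forall t, t <= t0 -> u t = line t).
  { intros t Ht.
    cut (u t - line t = 0); [lra |].
    apply (small_multiples_zero _ (2 * (G * wt t))). intros n.
    rewrite <- (iterate_past n t Ht). apply Hlim. }
  assert (Hfix : forall t, pos u t = u t).
  { intros t. destruct (Rle_lt_dec t t0) as [Ht | Ht].
    { rewrite Hpast by easy. now apply pos_past. }
    cut (pos u t - u t = 0); [lra |].
    apply (small_multiples_zero _ (2 * (G * wt t))). intros n.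
    replace (pos u t - u t)
      with ((pos u t - iterate (S n) t) - (u t - iterate (S n) t)) by ring.
    eapply Rle_trans; [apply Rabs_triang |]. rewrite Rabs_Ropp.
    pose proof (Hlim t (S n)) as H1. simpl ((1 / 2) ^ S n) in H1.
    assert (H2 : Rabs (pos u t - iterate (S n) t) <= 2 * G * (1 / 2) ^ n / 2 * wt t).
    { apply (pos_contraction u (iterate n)); auto; [| | lra].
      - specialize (Hhalf n). apply Rmult_le_pos; lra.
      - intros s _. eapply Rle_trans; [apply Hlim | right; ring]. }
    lra. }
  exists u, (mom u). split; [| split; [| split]].
  - rewrite <- Hfix. apply pos_start.
  - apply mom_start.
  - intros t. split; [| now apply mom_derive].
    apply (is_derive_ext (pos u)); [exact Hfix |]. now apply pos_derive.
  - exact Hpast.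
Qed.

End Picard.

(** * Disconjugacy and the Riccati equation *)

Definition newton (f : R -> R -> R) (u p : R -> R) : Prop :=
  forall t, is_derive u t (p t) /\ is_derive p t (- f (u t) t).

Definition jacobi (k xi dxi : R -> R) : Prop :=
  forall t, is_derive xi t (dxi t) /\ is_derive dxi t (- (k t * xi t)).

Definition disconjugate (k : R -> R) : Prop :=
  forall xi dxi, jacobi k xi dxi ->
  forall t1 t2, t1 < t2 -> xi t1 = 0 -> xi t2 = 0 -> forall t, xi t = 0.

(* Disconjugacy makes a Jacobi field that vanishes at [a - l] positive
   afterwards; being linear after [b], it cannot decrease there. *)
Lemma riccati_of_disconjugate (k : R -> R) (K a b c l : R) :
  (forall t, continuous k t) -> (forall t, Rabs (k t) <= K) ->
  (forall t, t <= a -> k t = 0) -> (forall t, b <= t -> k t = 0) ->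
  (forall t, c < t -> k t = 0) ->
  a <= b -> disconjugate k -> 0 < l ->
  exists w : R -> R,
    w a = 1 / l /\ 0 <= w b /\
    forall t, a <= t <= b -> is_derive w t (- k t - w t ^ 2).
Proof.
  intros Hc HK Ha Hb Hfree Hab Hdis Hl.
  assert (HK0 : 0 <= K) by (eapply Rle_trans; [apply Rabs_pos | apply (HK 0)]).
  (* The free line is [t - (a - l)]; the force on it can be nonzero only for [t] between [a - l] and
     [c], which gives the bound [G]. *)
  destruct (picard (fun x t => k t * x) K (K * Rabs (c - (a - l))) (a - l) 0 1)
    as (xi & dxi & Hx0 & Hd0 & Hode & _).
  - apply (jcont_mult (fun _ t => k t) (fun x _ => x)); [| apply jcont_fst].
    apply (jcont_comp_1 k (fun _ t => t) Hc jcont_snd).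
  - easy.
  - intros x y t. replace (k t * x - k t * y) with (k t * (x - y)) by ring.
    rewrite Rabs_mult. apply Rmult_le_compat_r; [apply Rabs_pos | apply HK].
  - intros t. assert (0 <= K * Rabs (c - (a - l)))
      by (apply Rmult_le_pos; [easy | apply Rabs_pos]).
    destruct (Rle_lt_dec t (a - l)) as [H1 | H1].
    { rewrite Ha, Rmult_0_l, Rabs_R0 by lra. easy. }
    destruct (Rlt_le_dec c t) as [H2 | H2].
    { rewrite Hfree, Rmult_0_l, Rabs_R0 by lra. easy. }
    rewrite Rabs_mult. apply Rmult_le_compat; try apply Rabs_pos; [apply HK |].
    rewrite !Rabs_pos_eq; lra.
  - intros t Ht. rewrite Ha by lra. ring.
  - assert (Hda : forall t, a - l <= t <= a -> dxi t = 1).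
    { intros t Ht.
      rewrite <- Hd0. apply derive_zero_increment; [lra |].
      intros s Hs. eapply is_derive_eq; [apply Hode |]. rewrite Ha by lra. ring. }
    assert (Hxa : xi a = l).
    { assert (H : xi a - a = xi (a - l) - (a - l)); [| lra].
      apply (derive_zero_increment (fun t => xi t - t)); [lra |].
      intros s Hs. apply is_derive_eq with (dxi s - 1).
      - apply (is_derive_minus xi); [apply Hode | apply (is_derive_id s)].
      - rewrite Hda by easy. ring. }
    assert (Hnz : forall t, a - l < t -> xi t <> 0).
    { intros t Ht E. pose proof (Hdis xi dxi Hode (a - l) t Ht Hx0 E a). lra. }
    assert (Hxpos : forall t, a <= t -> 0 < xi t).
    { intros t Ht. destruct (Rlt_le_dec 0 (xi t)) as [| H]; [easy | exfalso].
      destruct (IVT_gen xi a t 0) as [z [Hz Ez]].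
      - intros s. eapply is_derive_continuity_pt. apply Hode.
      - rewrite Hxa, Rmin_right, Rmax_left by lra. lra.
      - rewrite Rmin_left in Hz by lra. apply (Hnz z); lra. }
    assert (Hdb : 0 <= dxi b).
    { destruct (Rle_lt_dec 0 (dxi b)) as [| H]; [easy | exfalso].
      (* The zero of the tangent line to [xi] at [b], which [xi] would follow if its slope there
         were negative. *)
      set (z := b + xi b / - dxi b).
      pose proof (Hxpos b Hab).
      assert (Hz : b < z) by (unfold z; assert (0 < xi b / - dxi b)
        by (apply Rdiv_lt_0_compat; lra); lra).
      assert (Hd : forall t, b <= t -> dxi t = dxi b).
      { intros t Ht.
        apply derive_zero_increment; [easy |].
        intros s Hs. eapply is_derive_eq; [apply Hode |]. rewrite Hb by lra. ring. }
      assert (Hlin : xi z - xi b <= dxi b * z - dxi b * b).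
      { apply (increment_le xi (fun t => dxi b * t) dxi (fun _ => dxi b)); [lra | | |].
        - intros s _. apply Hode.
        - intros s _. apply is_derive_Rlinear.
        - intros s Hs. rewrite (Hd s); lra. }
      replace (dxi b * z - dxi b * b) with (- xi b) in Hlin by (unfold z; field; lra).
      pose proof (Hxpos z). lra. }
    exists (fun t => dxi t / xi t). split; [| split].
    + rewrite Hxa, Hda by lra. easy.
    + apply Rdiv_le_0_compat; [easy | now apply Hxpos].
    + intros t Ht. pose proof (Hxpos t (proj1 Ht)) as Hp.
      destruct (Hode t) as [H1 H2].
      eapply is_derive_eq; [apply (is_derive_div dxi xi t _ _ H2 H1); lra |].
      field. lra.
Qed.

(** * Free motion outside the strip *)

Section Orbits.

Context (f fu : R -> R -> R) (K U : R) (U_nonneg : 0 <= U).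
Context (f_derive : forall u t, is_derive (fun v => f v t) u (fu u t))
  (f_cont : jcont f)
  (f_bound : forall u t, Rabs (f u t) <= K) (fu_bound : forall u t, Rabs (fu u t) <= K)
  (f_out : forall u t, U < Rabs u -> f u t = 0).

Let K_nonneg : 0 <= K.
Proof. eapply Rle_trans; [apply Rabs_pos | apply (f_bound 0 0)]. Qed.

Let f_lip (x y t : R) : Rabs (f x t - f y t) <= K * Rabs (x - y).
Proof.
  apply (increment_abs_le_dist (fun v => f v t) (fun v => fu v t)); auto.
Qed.

Lemma newton_incoming (q P s : R) :
  U < q -> 0 < P ->
  exists u p, newton f u p /\ u s = - q /\ p s = P /\
    forall t, t <= s -> u t = - q + P * (t - s).
Proof.
  intros Hq HP.
  destruct (picard f K K s (- q) P) as (u & p & Hu & Hp & Hode & Hpast); auto.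
  - intros t Ht. apply f_out. rewrite Rabs_left1; nra.
  - exists u, p. auto.
Qed.

(** The line [l] stays beyond [U], where no force acts, so it solves the same equation. Uniqueness
    follows by Gronwall: [D' <= B * D] and [D s = 0]. *)
Lemma newton_outgoing (u p : R -> R) (s : R) :
  newton f u p -> U < u s -> 0 <= p s ->
  forall t, s <= t -> u t = u s + p s * (t - s).
Proof.
  intros Hode Hu Hp t Ht.
  set (l := fun t => u s + p s * (t - s)).
  set (D := fun t => (u t - l t) ^ 2 + (p t - p s) ^ 2).
  set (B := 1 + K).
  assert (Hl : forall t, is_derive l t (p s))
    by (intros; unfold l; auto_derive; [easy | ring]).
  assert (HD : D t * exp (- B * t) - D s * exp (- B * s) <= 0 - 0).
  { set (D' := fun t => 2 * (u t - l t) * (p t - p s) - 2 * (p t - p s) * f (u t) t).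
    apply (increment_le (fun t => D t * exp (- B * t)) (fun _ => 0)
             (fun t => (D' t - B * D t) * exp (- B * t)) (fun _ => 0)); [easy | | |].
    - intros r _. destruct (Hode r) as [H1 H2].
      assert (H3 : is_derive D r (D' r)).
      { unfold D, D'.
        eapply is_derive_eq.
        - apply (is_derive_plus (fun t => (u t - l t) ^ 2) (fun t => (p t - p s) ^ 2)).
          + apply (is_derive_pow (fun t => u t - l t)).
            apply (is_derive_minus u l); [exact H1 | apply Hl].
          + apply (is_derive_pow (fun t => p t - p s)).
            apply (is_derive_minus p); [exact H2 | apply (is_derive_const (p s))].
        - unfold plus, minus, plus, opp, zero; simpl. ring. }
      assert (H4 : is_derive (fun t => exp (- B * t)) r (- B * exp (- B * r)))
        by (auto_derive; [easy | ring]).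
      eapply is_derive_eq; [apply (is_derive_mult D _ r _ _ H3 H4); apply Rmult_comm |].
      unfold plus, mult; simpl. ring.
    - intros r _. apply (is_derive_const 0).
    - intros r Hr.
      assert (Hf : Rabs (f (u r) r) <= K * Rabs (u r - l r)).
      { replace (f (u r) r) with (f (u r) r - f (l r) r); [apply f_lip |].
        rewrite (f_out (l r)); [ring |].
        assert (0 <= p s * (r - s)) by (apply Rmult_le_pos; lra).
        unfold l. rewrite Rabs_pos_eq; lra. }
      assert (D' r <= B * D r).
      { unfold D', D, B. set (x := u r - l r) in *. set (y := p r - p s).
        assert (- (y * f (u r) r) <= K * (Rabs x * Rabs y)).
        { apply Rle_trans with (Rabs (- (y * f (u r) r))); [apply Rle_abs |].
          rewrite Rabs_Ropp, Rabs_mult. pose proof (Rabs_pos y). nra. }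
        assert (2 * (Rabs x * Rabs y) <= x ^ 2 + y ^ 2).
        { rewrite <- (pow2_abs x), <- (pow2_abs y).
          pose proof (pow2_ge_0 (Rabs x - Rabs y)). nra. }
        pose proof (pow2_ge_0 (x - y)). nra. }
      pose proof (exp_pos (- B * r)).
      assert (0 <= (B * D r - D' r) * exp (- B * r)) by (apply Rmult_le_pos; lra).
      lra. }
  assert (HDs : D s = 0) by (unfold D, l; ring).
  rewrite HDs in HD.
  pose proof (exp_pos (- B * t)).
  assert (HDt : D t <= 0) by nra.
  unfold D in HDt.
  pose proof (pow2_ge_0 (u t - l t)). pose proof (pow2_ge_0 (p t - p s)).
  fold (l t). assert ((u t - l t) ^ 2 = 0) by lra. nra.
Qed.

End Orbits.

(** * Fast orbits *)

Lemma Rabs_mult_le (x y X Y : R) : Rabs x <= X -> Rabs y <= Y -> Rabs (x * y) <= X * Y.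
Proof.
  intros Hx Hy. rewrite Rabs_mult.
  apply Rmult_le_compat; auto; apply Rabs_pos.
Qed.

Lemma Rabs_plus_le (x y X Y : R) : Rabs x <= X -> Rabs y <= Y -> Rabs (x + y) <= X + Y.
Proof. intros Hx Hy. eapply Rle_trans; [apply Rabs_triang | lra]. Qed.

Lemma Rabs_minus_le (x y X Y : R) : Rabs x <= X -> Rabs y <= Y -> Rabs (x - y) <= X + Y.
Proof. intros Hx Hy. apply Rabs_plus_le; [| rewrite Rabs_Ropp]; easy. Qed.

Lemma Rabs_const_le (x : R) : 0 <= x -> Rabs x <= x.
Proof. intros H. rewrite Rabs_pos_eq; lra. Qed.

Ltac rabs_bound :=
  repeat first
    [ eassumption
    | apply Rabs_mult_le | apply Rabs_minus_le | apply Rabs_plus_le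
    | apply Rabs_const_le; lra ].

(* Here [eta] stands for [h - P ^ 2 / 2], the energy gained since entering the strip.
   In the variables [i = 1 / P], [al = (p - P) * P], [e = eta * P] the energy relation
   reads [F = e * i - al ^ 2 * i ^ 2 / 2 - al], and the terms of order [P] and [1] cancel. *)
Lemma crossing_error (P K A m p F Fs Fss eta : R) :
  1 <= P -> 0 <= A ->
  Rabs F <= K -> Rabs Fs <= K -> Rabs Fs <= m -> Rabs Fss <= m ->
  Rabs (p - P) <= A / P -> Rabs eta <= A / P ->
  p ^ 2 / 2 + F = P ^ 2 / 2 + eta ->
  Rabs (p * (Fss + (F * Fss + Fs ^ 2) / P ^ 2)
        - P * (Fss * (1 + eta / P ^ 2) ^ 2 + 2 * Fs ^ 2 * (1 + eta / P ^ 2) / P ^ 2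
               - p ^ 2 * Fs ^ 2 / P ^ 4))
  <= (3 * A + 2 * A ^ 2 + A * K + K * (5 * A + A ^ 2)) * m / P ^ 2.
Proof.
  intros HP HA HF HFs HFsm HFss Hp Heta Hen.
  set (i := / P).
  assert (Hi : 0 < i <= 1).
  { unfold i. split; [apply Rinv_0_lt_compat; lra |].
    rewrite <- Rinv_1. apply Rinv_le_contravar; lra. }
  assert (HPi : P = / i) by (unfold i; now rewrite Rinv_inv).
  assert (Hi1 : Rabs i <= 1) by (rewrite Rabs_pos_eq; lra).
  set (al := (p - P) * P). set (e := eta * P).
  assert (Hal : Rabs al <= A).
  { unfold al. apply Rle_trans with (A / P * P); [| right; field; lra].
    apply Rabs_mult_le; [easy |]. apply Rabs_const_le; lra. }
  assert (He : Rabs e <= A).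
  { unfold e. apply Rle_trans with (A / P * P); [| right; field; lra].
    apply Rabs_mult_le; [easy |]. apply Rabs_const_le; lra. }
  assert (Ep : p = / i + al * i) by (unfold al, i; field; lra).
  assert (Ee : eta = e * i) by (unfold e, i; field; lra).
  assert (EF : F = e * i - al ^ 2 * i ^ 2 / 2 - al).
  { assert (F = P ^ 2 / 2 + eta - p ^ 2 / 2) as -> by lra.
    rewrite Ep, Ee, HPi. field. lra. }
  (* The remainder with [i * i] factored out. Every term contains [al] or [e], both at most [A];
     adding up the bounds gives the stated constant, with [3 / 2] rounded up to [2]. *)
  set (X := Fss * ((e - al * al * i * (1 / 2)) + al * F * i - 2 * e - e * e * (i * i * i))
            + Fs * Fs * (3 * al * i + al * al * (i * i * i) - 2 * e * (i * i))).
  assert (EX : p * (Fss + (F * Fss + Fs ^ 2) / P ^ 2)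
        - P * (Fss * (1 + eta / P ^ 2) ^ 2 + 2 * Fs ^ 2 * (1 + eta / P ^ 2) / P ^ 2
               - p ^ 2 * Fs ^ 2 / P ^ 4) = X * (i * i)).
  { unfold X. rewrite Ep, Ee, HPi, EF. field. lra. }
  rewrite EX.
  replace ((3 * A + 2 * A ^ 2 + A * K + K * (5 * A + A ^ 2)) * m / P ^ 2)
    with ((3 * A + 2 * A ^ 2 + A * K + K * (5 * A + A ^ 2)) * m * (i * i))
    by (rewrite HPi; field; lra).
  assert (Hm : 0 <= m) by (eapply Rle_trans; [apply Rabs_pos | exact HFss]).
  assert (HK : 0 <= K) by (eapply Rle_trans; [apply Rabs_pos | exact HF]).
  apply Rabs_mult_le; [| apply Rabs_const_le; nra].
  assert (Hsq : Rabs (Fs * Fs) <= m * K) by (apply Rabs_mult_le; easy).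
  unfold X.
  eapply Rle_trans; [rabs_bound |].
  assert (0 <= m * A ^ 2) by (apply Rmult_le_pos; nra).
  nra.
Qed.

Section FastOrbits.

Context (F Fu Fuu Fs Fus Fss Fsss : R -> R -> R) (M K U T : R).
Context
  (dF_u : forall u s, is_derive (fun v => F v s) u (Fu u s))
  (dFu_u : forall u s, is_derive (fun v => Fu v s) u (Fuu u s))
  (dFs_u : forall u s, is_derive (fun v => Fs v s) u (Fus u s))
  (dF_s : forall u s, is_derive (F u) s (Fs u s))
  (dFu_s : forall u s, is_derive (Fu u) s (Fus u s))
  (dFs_s : forall u s, is_derive (Fs u) s (Fss u s))
  (dFss_s : forall u s, is_derive (Fss u) s (Fsss u s))
  (cF : jcont F) (cFu : jcont Fu) (cFuu : jcont Fuu)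
  (cFs : jcont Fs) (cFus : jcont Fus) (cFss : jcont Fss)
  (U_pos : 0 < U)
  (bF : forall u s, Rabs (F u s) <= K) (bFu : forall u s, Rabs (Fu u s) <= K)
  (bFuu : forall u s, Rabs (Fuu u s) <= K) (bFs : forall u s, Rabs (Fs u s) <= K)
  (eF : forall u s, Rabs (F u s) <= M * exp (2 * s))
  (eFs : forall u s, Rabs (Fs u s) <= M * exp (2 * s))
  (eFss : forall u s, Rabs (Fss u s) <= M * exp (2 * s))
  (eFsss : forall u s, Rabs (Fsss u s) <= M * exp (2 * s))
  (oF : forall u s, U < Rabs u -> F u s = 0)
  (oFu : forall u s, U < Rabs u -> Fu u s = 0)
  (oFuu : forall u s, U < Rabs u -> Fuu u s = 0)
  (oFs : forall u s, U < Rabs u -> Fs u s = 0)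
  (oFss : forall u s, U < Rabs u -> Fss u s = 0)
  (tF : forall u s, T < s -> F u s = 0)
  (tFuu : forall u s, T < s -> Fuu u s = 0)
  (tFs : forall u s, T < s -> Fs u s = 0)
  (no_conjugate : forall u p, newton Fu u p -> disconjugate (fun t => Fuu (u t) t)).

(** The unit margin puts the endpoints [- q] and [q] strictly outside the support, where [F] and its
    derivatives vanish. *)
Let q : R := U + 1.
(** [A / P] is [K] times the time [4 * q / P] granted to a crossing, and [K] bounds both [Fu] and
    [Fs]: it limits the change of speed and of energy. *)
Let A : R := 4 * K * q.

Let K_nonneg : 0 <= K.
Proof. eapply Rle_trans; [apply Rabs_pos | apply (bF 0 0)]. Qed.

Let M_nonneg : 0 <= M.
Proof.
  pose proof (eF 0 0) as H. rewrite Rmult_0_r, exp_0, Rmult_1_r in H.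
  eapply Rle_trans; [apply Rabs_pos | exact H].
Qed.

Let A_nonneg : 0 <= A.
Proof. unfold A, q. apply Rmult_le_pos; nra. Qed.

Let Z (P y s : R) : R := F y s + F y s ^ 2 / (2 * P ^ 2).
Let Zs (P y s : R) : R := Fs y s + F y s * Fs y s / P ^ 2.
Let Zss (P y s : R) : R := Fss y s + (F y s * Fss y s + Fs y s ^ 2) / P ^ 2.
Let Zsss (P y s : R) : R :=
  Fsss y s + (3 * (Fs y s * Fss y s) + F y s * Fsss y s) / P ^ 2.

Let dZss (P y s : R) : 0 < P -> is_derive (Zss P y) s (Zsss P y s).
Proof.
  intros HP.
  assert (H1 := dF_s y s). assert (H2 := dFs_s y s). assert (H3 := dFss_s y s).
  unfold Zss, Zsss.
  eapply is_derive_eq; [derive_poly | field; lra].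
Qed.

Let Zsss_bound (P y s : R) :
  1 <= P -> Rabs (Zsss P y s) <= (1 + 4 * K) * (M * exp (2 * s)).
Proof.
  intros HP. unfold Zsss.
  assert (Hi : 0 < / P ^ 2 <= 1).
  { split; [apply Rinv_0_lt_compat; nra |].
    rewrite <- Rinv_1. apply Rinv_le_contravar; nra. }
  pose proof (bFs y s) as B1. pose proof (eFss y s) as B2. pose proof (bF y s) as B3.
  pose proof (eFsss y s) as B4. set (m := M * exp (2 * s)) in *.
  assert (B5 : Rabs (/ P ^ 2) <= 1) by (rewrite Rabs_pos_eq; lra).
  unfold Rdiv. eapply Rle_trans.
  - apply Rabs_plus_le; [exact B4 |]. apply Rabs_mult_le; [| exact B5].
    apply Rabs_plus_le; [apply Rabs_mult_le; [apply Rabs_const_le; lra |] |].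
    + apply Rabs_mult_le; [exact B1 | exact B2].
    + apply Rabs_mult_le; [exact B3 | exact B4].
  - nra.
Qed.

(** The first four terms come from [crossing_error]; the last is the cost of replacing the time [t]
    by [tau (u t)]. *)
Let C0 : R :=
  3 * A + 2 * A ^ 2 + A * K + K * (5 * A + A ^ 2) + 2 * ((1 + 4 * K) * (4 * q * A)).

Let C0_nonneg : 0 <= C0.
Proof.
  unfold C0, q.
  assert (0 <= A * K) by nra. assert (0 <= A ^ 2) by nra.
  assert (0 <= K * A ^ 2) by nra.
  assert (0 <= (1 + 4 * K) * (4 * (U + 1) * A)) by (apply Rmult_le_pos; nra).
  nra.
Qed.

(** * A single crossing of the strip *)

Section OneOrbit.

Context (P s0 : R) (u p : R -> R).
Context (P_large : 1 <= P) (P_q : 4 * q <= P) (P_A : 2 * A <= P) (P_qA : 4 * q * A <= P)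
  (orb : newton Fu u p) (u_start : u s0 = - q) (p_start : p s0 = P)
  (u_past : forall t, t <= s0 -> u t = - q + P * (t - s0)).

(** The time to cover the width [2 * q] at speed [P / 2]. That the speed stays above [P / 2] follows
    from the global bound on [Fu], so nothing is circular. *)
Let d : R := 4 * q / P.
Let t2 : R := s0 + d.
(** The crossing ends before [s0 + 1], and [tau (u t)] is within 1 of [t], so [s0 + 2] covers every
    time that occurs. *)
Let m : R := M * exp (2 * (s0 + 2)).

Let d_range : 0 < d <= 1.
Proof.
  unfold d, q in *. split; [apply Rdiv_lt_0_compat; lra |].
  apply Rmult_le_reg_r with P; [lra |]. unfold Rdiv.
  rewrite Rmult_assoc, Rinv_l by lra. lra.
Qed.

Let Kd : K * d = A / P.
Proof. unfold d, A. field. lra. Qed.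

Let p_close (t : R) : s0 <= t <= t2 -> Rabs (p t - P) <= A / P.
Proof.
  intros Ht. rewrite <- Kd.
  replace (p t - P) with (p t - p s0) by (rewrite p_start; ring).
  apply Rle_trans with (K * (t - s0)).
  - apply (increment_abs_le_linear p (fun t => - Fu (u t) t)); [easy | |].
    + intros s _. apply orb.
    + intros s _. rewrite Rabs_Ropp. apply bFu.
  - apply Rmult_le_compat_l; unfold t2 in Ht; lra.
Qed.

Let A_div_P : A / P <= P / 2.
Proof.
  apply Rmult_le_reg_r with P; [lra |]. unfold Rdiv at 1.
  rewrite Rmult_assoc, Rinv_l by lra. nra.
Qed.

Let p_range (t : R) : s0 <= t <= t2 -> P / 2 <= p t <= 2 * P.
Proof.
  intros Ht. apply p_close in Ht. apply Rabs_le_between in Ht. lra.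
Qed.

Let u_exit : q <= u t2.
Proof.
  assert (P / 2 * t2 - P / 2 * s0 <= u t2 - u s0).
  { apply (increment_le (fun t => P / 2 * t) u (fun _ => P / 2) p).
    - unfold t2. lra.
    - intros t _. apply is_derive_Rlinear.
    - intros t _. apply orb.
    - intros t Ht. now apply p_range. }
  replace (P / 2 * t2 - P / 2 * s0) with (2 * q) in H by (unfold t2, d; field; lra).
  lra.
Qed.

(** Together with [u_before], this confines the Jacobi coefficient to [[s0, t2]], as
    [riccati_of_disconjugate] requires. *)
Let u_future (t : R) : t2 <= t -> q <= u t.
Proof.
  intros Ht.
  assert (Hp : P / 2 <= p t2 <= 2 * P) by (apply p_range; unfold t2; lra).
  rewrite (newton_outgoing Fu Fuu K U (Rlt_le _ _ U_pos) dFu_u bFu bFuu oFu u p t2 orb).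
  - assert (0 <= p t2 * (t - t2)) by (apply Rmult_le_pos; lra). lra.
  - unfold q in u_exit. lra.
  - lra.
  - easy.
Qed.

Let out_q (x : R) : q <= x -> U < Rabs x.
Proof. intros H. unfold q in H. rewrite Rabs_pos_eq; lra. Qed.

Let out_mq (x : R) : x <= - q -> U < Rabs x.
Proof. intros H. unfold q in H. rewrite Rabs_left1; lra. Qed.

Let u_before (t : R) : t <= s0 -> U < Rabs (u t).
Proof.
  intros Ht. apply out_mq. rewrite u_past by easy.
  assert (0 <= P * (s0 - t)) by (apply Rmult_le_pos; lra). lra.
Qed.

Let eta (t : R) : R := p t ^ 2 / 2 + F (u t) t - P ^ 2 / 2.

Let along (f fu ft : R -> R -> R) (t : R) :
  (forall u s, is_derive (fun v => f v s) u (fu u s)) ->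
  (forall u s, is_derive (f u) s (ft u s)) -> jcont fu ->
  is_derive (fun t => f (u t) t) t (fu (u t) t * p t + ft (u t) t).
Proof.
  intros H1 H2 H3.
  eapply is_derive_eq.
  - apply (is_derive_along f fu ft u (fun t => t) t (p t) 1 H1 H2 H3).
    + apply orb.
    + apply (is_derive_id t).
  - ring.
Qed.

Let deta (t : R) : is_derive eta t (Fs (u t) t).
Proof.
  unfold eta. destruct (orb t) as [_ Hp].
  pose proof (along F Fu Fs t dF_u dF_s cFu) as HF.
  eapply is_derive_eq; [derive_poly | field].
Qed.

Let eta_start : eta s0 = 0.
Proof.
  unfold eta. rewrite p_start, oF by (apply u_before; lra). field.
Qed.

Let eta_small (t : R) : s0 <= t <= t2 -> Rabs (eta t) <= A / P.
Proof.
  intros Ht. replace (eta t) with (eta t - eta s0) by (rewrite eta_start; ring).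
  rewrite <- Kd. apply Rle_trans with (K * (t - s0)).
  - apply (increment_abs_le_linear eta (fun t => Fs (u t) t)); [easy | auto |].
    intros s _. apply bFs.
  - apply Rmult_le_compat_l; unfold t2 in Ht; lra.
Qed.

(** The time at which free motion of speed [P] reaches [y]. *)
Let tau (y : R) : R := s0 + (y + q) / P.

(** [u t - P * t] drifts at a rate at most [A / P] for a time [4 * q / P]; one more division by [P]
    converts distance into time. *)
Let tau_close (t : R) : s0 <= t <= t2 -> Rabs (tau (u t) - t) <= 4 * q * A / P ^ 3.
Proof.
  intros Ht.
  assert (H : Rabs ((u t - P * t) - (u s0 - P * s0)) <= A / P * (t - s0)).
  { apply (increment_abs_le_linear (fun t => u t - P * t) (fun t => p t - P)); [easy | |].
    - intros s _. apply (is_derive_minus u); [apply orb |].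
      apply is_derive_Rlinear.
    - intros s Hs. apply p_close. lra. }
  replace (tau (u t) - t) with (((u t - P * t) - (u s0 - P * s0)) * / P)
    by (unfold tau; rewrite u_start; field; lra).
  replace (4 * q * A / P ^ 3) with (A / P * d * / P) by (unfold d; field; lra).
  apply Rabs_mult_le.
  - eapply Rle_trans; [exact H |]. apply Rmult_le_compat_l.
    + apply Rdiv_le_0_compat; lra.
    + unfold t2 in Ht. lra.
  - apply Rabs_const_le. left. apply Rinv_0_lt_compat. lra.
Qed.

Let m_bound (s : R) : s <= s0 + 2 -> M * exp (2 * s) <= m.
Proof.
  intros Hs. unfold m. apply Rmult_le_compat_l; [easy |]. apply exp_le_compat. lra.
Qed.

Let zeta (t : R) : R := 1 + eta t / P ^ 2.
Let N (t : R) : R :=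
  Fss (u t) t * zeta t ^ 2 + 2 * Fs (u t) t ^ 2 * zeta t / P ^ 2
  - p t ^ 2 * Fs (u t) t ^ 2 / P ^ 4.

(** With [y = u t] one has [dy = p dt], so the first term is the integrand of
    [int Zss P y (tau y) dy]. [crossing_error] compares it with [P * N t] at time [t], and the bound
    on [Zsss] pays for the shift from [t] to [tau (u t)]. *)
Let N_estimate (t : R) :
  s0 <= t <= t2 -> p t * Zss P (u t) (tau (u t)) - P * N t <= C0 * m / P ^ 2.
Proof.
  intros Ht.
  assert (Ht' : t <= s0 + 1) by (unfold t2 in Ht; lra).
  assert (Hm : M * exp (2 * t) <= m) by (apply m_bound; lra).
  assert (Hm0 : 0 <= m)
    by (unfold m; apply Rmult_le_pos; [easy | left; apply exp_pos]).
  assert (H1 : Rabs (p t * Zss P (u t) t - P * N t)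
     <= (3 * A + 2 * A ^ 2 + A * K + K * (5 * A + A ^ 2)) * m / P ^ 2).
  { unfold Zss, N, zeta. apply crossing_error; auto.
    - eapply Rle_trans; [apply eFs | easy].
    - eapply Rle_trans; [apply eFss | easy].
    - unfold eta. ring. }
  assert (Hq3 : 4 * q * A / P ^ 3 <= 1).
  { apply Rmult_le_reg_r with (P ^ 3); [apply pow_lt; lra |].
    unfold Rdiv. rewrite Rmult_assoc, Rinv_l by (apply pow_nonzero; lra).
    assert (P <= P ^ 3) by (assert (1 <= P ^ 2) by nra; nra). lra. }
  pose proof (tau_close t Ht) as Htau.
  assert (H2 : Rabs (Zss P (u t) (tau (u t)) - Zss P (u t) t)
               <= (1 + 4 * K) * m * (4 * q * A / P ^ 3)).
  { eapply Rle_trans.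
    - apply (increment_abs_le_dist (Zss P (u t)) (Zsss P (u t)) t (tau (u t))
               ((1 + 4 * K) * m)).
      + intros s. apply dZss. lra.
      + intros s Hs. eapply Rle_trans; [now apply Zsss_bound |].
        apply Rmult_le_compat_l; [lra |]. apply m_bound.
        eapply Rle_trans; [exact Hs |]. apply Rabs_le_between in Htau.
        apply Rmax_lub; lra.
    - apply Rmult_le_compat_l; [| exact Htau]. apply Rmult_le_pos; lra. }
  assert (H3 : Rabs (p t * (Zss P (u t) (tau (u t)) - Zss P (u t) t))
               <= 2 * P * ((1 + 4 * K) * m * (4 * q * A / P ^ 3))).
  { apply Rabs_mult_le; [| exact H2].
    pose proof (p_range t Ht). rewrite Rabs_pos_eq; lra. }
  replace (2 * P * ((1 + 4 * K) * m * (4 * q * A / P ^ 3)))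
    with (2 * ((1 + 4 * K) * (4 * q * A)) * m / P ^ 2) in H3 by (field; lra).
  apply Rabs_le_between in H1. apply Rabs_le_between in H3.
  replace (C0 * m / P ^ 2) with
    ((3 * A + 2 * A ^ 2 + A * K + K * (5 * A + A ^ 2)) * m / P ^ 2
     + 2 * ((1 + 4 * K) * (4 * q * A)) * m / P ^ 2) by (unfold C0; field; lra).
  lra.
Qed.

Let cZss_tau (y : R) : continuous (fun y => Zss P y (tau y)) y.
Proof.
  assert (Ht : continuous tau y).
  { apply (ex_derive_continuous tau). unfold tau. auto_derive. lra. }
  assert (C : forall f, jcont f -> continuous (fun y => f y (tau y)) y).
  { intros f Hf. apply (continuous_jcont_comp f (fun y => y) tau); auto.
    apply continuous_id. }
  unfold Zss.
  apply (continuous_plus (fun y => Fss y (tau y))); [now apply C |].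
  apply (continuous_mult _ (fun _ => / P ^ 2)); [| apply continuous_const].
  apply (continuous_plus (fun y => F y (tau y) * Fss y (tau y))).
  - apply (continuous_mult (fun y => F y (tau y))); now apply C.
  - apply (continuous_ext (fun y => Fs y (tau y) * Fs y (tau y))); [intros; simpl; ring |].
    apply (continuous_mult (fun y => Fs y (tau y))); now apply C.
Qed.

(* Completing the square in the index form of the variation [p * zeta] leaves
   [- N] as an upper bound for the derivative of the boundary term [B]. *)
Let crossing_with (l : R) :
  0 < l ->
  RInt (fun y => Zss P y (tau y)) (- q) q <= P ^ 3 / l + 4 * q * C0 * m / P ^ 3.
Proof.
  intros Hl.
  assert (Hk : forall t, continuous (fun t => Fuu (u t) t) t).
  { intros t. apply (continuous_jcont_comp Fuu u (fun t => t)); auto.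
    - apply (ex_derive_continuous u). eexists. apply orb.
    - apply continuous_id. }
  destruct (riccati_of_disconjugate (fun t => Fuu (u t) t) K s0 t2 T l)
    as (w & Hw1 & Hw2 & Hw); auto.
  { unfold t2. lra. }
  { eapply no_conjugate, orb. }
  (* With [x = p * zeta] and [k] the Jacobi coefficient, the Riccati equation gives
     [(w x^2)' = x'^2 - k x^2 - sq^2]. The other two terms of [B] are the total derivative that
     turns [x'^2 - k x^2] into [- N]. *)
  set (B := fun t => (w t * p t ^ 2 + p t * Fu (u t) t - Fs (u t) t) * zeta t ^ 2).
  set (sq := fun t => (w t * p t + Fu (u t) t) * zeta t - p t * (Fs (u t) t / P ^ 2)).
  assert (HB : forall t, s0 <= t <= t2 -> is_derive B t (- sq t ^ 2 - N t)).
  { intros t Ht. specialize (Hw t Ht). destruct (orb t) as [_ Hp].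
    assert (HFu := along Fu Fuu Fus t dFu_u dFu_s cFuu).
    assert (HFs := along Fs Fus Fss t dFs_u dFs_s cFus).
    assert (Hz : is_derive zeta t (Fs (u t) t / P ^ 2)).
    { unfold zeta. pose proof (deta t) as He.
      eapply is_derive_eq; [derive_poly | field; lra]. }
    unfold B. eapply is_derive_eq; [derive_poly | unfold sq, N; field; lra]. }
  set (D := fun t => RInt (fun y => Zss P y (tau y)) (- q) (u t)).
  assert (HD : forall t, is_derive D t (p t * Zss P (u t) (tau (u t)))).
  { intros t. apply (is_derive_comp (fun x => RInt (fun y => Zss P y (tau y)) (- q) x) u).
    - apply (is_derive_RInt_upper (fun y => Zss P y (tau y))). apply cZss_tau.
    - apply orb. }
  assert (H : (P * B t2 + D t2) - (P * B s0 + D s0)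
              <= C0 * m / P ^ 2 * t2 - C0 * m / P ^ 2 * s0).
  { apply (increment_le (fun t => P * B t + D t) (fun t => C0 * m / P ^ 2 * t)
             (fun t => P * (- sq t ^ 2 - N t) + p t * Zss P (u t) (tau (u t)))
             (fun _ => C0 * m / P ^ 2)).
    - unfold t2. lra.
    - intros t Ht. apply (is_derive_plus (fun t => P * B t) D); [| apply HD].
      apply (is_derive_scal B). now apply HB.
    - intros t _. apply is_derive_Rlinear.
    - intros t Ht. pose proof (N_estimate t Ht). pose proof (pow2_ge_0 (sq t)). nra. }
  assert (HBs : B s0 = P ^ 2 / l).
  { unfold B, zeta. rewrite eta_start, Hw1, p_start, oFu, oFs by (apply u_before; lra).
    field. lra. }
  assert (HBt : 0 <= B t2).
  { unfold B. rewrite oFu, oFs by (apply out_q, u_exit).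
    rewrite Rmult_0_r, Rplus_0_r, Rminus_0_r.
    apply Rmult_le_pos; [apply Rmult_le_pos |]; auto using pow2_ge_0. }
  assert (HDs : D s0 = 0).
  { unfold D. rewrite u_start. exact (RInt_point (- q) _). }
  assert (HDt : D t2 = RInt (fun y => Zss P y (tau y)) (- q) q).
  { unfold D.
    (* The orbit may have gone beyond [q] by the time [t2]; the integrand is zero there. *)
    rewrite <- (RInt_Chasles (fun y => Zss P y (tau y)) (- q) q (u t2))
      by now apply ex_RInt_cont.
    rewrite (RInt_zero _ q (u t2)); [apply Rplus_0_r |].
    rewrite Rmin_left, Rmax_right by easy. intros y Hy.
    assert (U < Rabs y) by (apply out_q; lra).
    unfold Zss. rewrite oFss, oFs by easy. field. lra. }
  rewrite HBs, HDs, HDt in H.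
  replace (C0 * m / P ^ 2 * t2 - C0 * m / P ^ 2 * s0) with (4 * q * C0 * m / P ^ 3) in H
    by (unfold t2, d; field; lra).
  replace (P ^ 3 / l) with (P * (P ^ 2 / l)) by (field; lra).
  assert (0 <= P * B t2) by (apply Rmult_le_pos; lra).
  lra.
Qed.

Lemma crossing_orbit :
  RInt (fun y => Zss P y (s0 + (y + q) / P)) (- q) q <= 4 * q * C0 * m / P ^ 3.
Proof.
  apply le_epsilon. intros e He.
  assert (HP3 : 0 < P ^ 3) by (apply pow_lt; lra).
  (* The incoming boundary term [P ^ 3 / l] disappears as the zero of the Jacobi field recedes to
     the far past; this [l] makes it equal to [e]. *)
  pose proof (crossing_with (P ^ 3 / e) ltac:(now apply Rdiv_lt_0_compat)) as H.
  replace (P ^ 3 / (P ^ 3 / e)) with e in H by (field; lra).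
  unfold tau in H. lra.
Qed.

End OneOrbit.

Let C1 : R := 4 * q * C0 * (M * exp 4).

Let crossing (P s0 : R) :
  1 + 4 * q + 2 * A + 4 * q * A <= P ->
  RInt (fun y => Zss P y (s0 + (y + q) / P)) (- q) q <= C1 * exp (2 * s0) / P ^ 3.
Proof.
  intros HP.
  assert (Hq : 0 < q) by (unfold q; lra).
  assert (HqA : 0 <= 4 * q * A) by (apply Rmult_le_pos; lra).
  destruct (newton_incoming Fu Fuu K U (Rlt_le _ _ U_pos) dFu_u cFu bFu bFuu oFu q P s0)
    as (u & p & Horb & Hu & Hp & Hpast); [unfold q; lra | lra |].
  replace (C1 * exp (2 * s0) / P ^ 3)
    with (4 * q * C0 * (M * exp (2 * (s0 + 2))) / P ^ 3).
  - apply (crossing_orbit P s0 u p); auto; lra.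
  - replace (2 * (s0 + 2)) with (2 * s0 + 4) by ring. rewrite exp_plus.
    unfold C1. field. lra.
Qed.

(** Beyond [T], so that [Z] vanishes from [b] on and every [s <= T] lies in the interior of an
    interval ending at [b]. *)
Let b : R := T + 1.
Let Zu (P y s : R) : R := Fu y s + F y s * Fu y s / P ^ 2.
(** For [s <= b], minus the integral of [Z] from [s] to [b]. Its sheared integral over [y] has as
    third derivative the quantity that [crossing] bounds. *)
Let Psi (P y s : R) : R := RInt (Z P y) b s.

Let k1 : R := 2 * q * ((1 + K) * (M * exp 2)).
(** The first term is the accumulated failure of concavity; the second bounds the values at the left
    end [a], where [exp (2 * a) <= 8 / P ^ 3]. *)
Let C2 : R := C1 * exp (2 * b) + 8 * k1.

(** * Integration over the entry time at a fixed speed *)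

Section FixedSpeed.

Context (P : R) (P_large : 1 + 4 * q + 2 * A + 4 * q * A <= P).

Let q_pos : 0 < q.
Proof. unfold q. lra. Qed.

Let P_ge_1 : 1 <= P.
Proof. assert (0 <= 4 * q * A) by (apply Rmult_le_pos; lra). lra. Qed.

Let P_ge_2q : 2 * q <= P.
Proof. assert (0 <= 4 * q * A) by (apply Rmult_le_pos; lra). lra. Qed.

Let dZ_u (y s : R) : is_derive (fun y => Z P y s) y (Zu P y s).
Proof.
  unfold Z, Zu. pose proof (dF_u y s) as H.
  eapply is_derive_eq; [derive_poly | field; lra].
Qed.

Let dZ_s (y s : R) : is_derive (Z P y) s (Zs P y s).
Proof.
  unfold Z, Zs. pose proof (dF_s y s) as H.
  eapply is_derive_eq; [derive_poly | field; lra].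
Qed.

Let dZs_s (y s : R) : is_derive (Zs P y) s (Zss P y s).
Proof.
  unfold Zs, Zss. pose proof (dF_s y s) as H1. pose proof (dFs_s y s) as H2.
  eapply is_derive_eq; [derive_poly | field; lra].
Qed.

Let jcont_quadratic (f g h : R -> R -> R) (c : R) :
  jcont f -> jcont g -> jcont h -> jcont (fun y s => f y s + g y s * h y s / c).
Proof.
  intros Hf Hg Hh. apply (jcont_plus f); [easy |].
  apply (jcont_mult (fun y s => g y s * h y s) (fun _ _ => / c)); [| apply jcont_const].
  now apply jcont_mult.
Qed.

Let cZ : jcont (Z P).
Proof.
  intros y s.
  apply (continuity_2d_pt_ext (fun y s => F y s + F y s * F y s / (2 * P ^ 2))).
  - intros. unfold Z. field. lra.
  - now apply jcont_quadratic.
Qed.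

Let cZu : jcont (Zu P).
Proof. now apply jcont_quadratic. Qed.

Let cZs : jcont (Zs P).
Proof. now apply jcont_quadratic. Qed.

Let cZss : jcont (Zss P).
Proof.
  intros y s.
  apply (continuity_2d_pt_ext
    (fun y s => (Fss y s + F y s * Fss y s / P ^ 2) + Fs y s * Fs y s / P ^ 2)).
  - intros. unfold Zss. field. lra.
  - now apply (jcont_quadratic (fun y s => Fss y s + F y s * Fss y s / P ^ 2));
      [apply jcont_quadratic | |].
Qed.

Let cont_s (f : R -> R -> R) (y s : R) : jcont f -> continuous (f y) s.
Proof.
  intros Hf. apply (continuous_jcont_comp f (fun _ => y) (fun s => s)); auto.
  - apply continuous_const.
  - apply continuous_id.
Qed.

Let tau (y : R) : R := (y + q) / P.

Let dtau (y : R) : is_derive tau y (1 / P).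
Proof.
  unfold tau. apply is_derive_Rdiv_const. auto_derive; [easy | ring].
Qed.

Let tau_range (y : R) : - q <= y <= q -> 0 <= tau y <= 1.
Proof.
  intros Hy. unfold tau. split.
  - apply Rdiv_le_0_compat; lra.
  - apply Rmult_le_reg_r with P; [lra |].
    unfold Rdiv. rewrite Rmult_assoc, Rinv_l by lra. lra.
Qed.

Let jcont_tau (f : R -> R -> R) : jcont f -> jcont (fun y s => f y (s + tau y)).
Proof.
  intros Hf. apply (jcont_comp f (fun y _ => y) (fun y s => s + tau y)); auto.
  - apply jcont_fst.
  - apply (jcont_plus (fun _ s => s) (fun y _ => tau y)); [apply jcont_snd |].
    apply (jcont_comp_1 tau (fun y _ => y)); [| apply jcont_fst].
    intros x. apply (ex_derive_continuous tau). eexists. apply dtau.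
Qed.

Let cont_y (f : R -> R -> R) (s y : R) : jcont f -> continuous (fun y => f y s) y.
Proof.
  intros Hf. apply (continuous_jcont_comp f (fun y => y) (fun _ => s)); auto.
  - apply continuous_id.
  - apply continuous_const.
Qed.

Let dPsi (y s : R) : is_derive (Psi P y) s (Z P y s).
Proof. apply (is_derive_RInt_upper (Z P y)). intros x. now apply cont_s. Qed.

Let cPsi_tau (s y : R) : continuous (fun y => Psi P y (s + tau y)) y.
Proof.
  apply (continuous_RInt_parameter (Z P) (Zu P) b (0 + 1 / P) b y (fun y => s + tau y)); auto.
  apply (is_derive_Rplus (fun _ => s) tau); [apply is_derive_Rconst | apply dtau].
Qed.

Let cPsi (s y : R) : continuous (fun y => Psi P y s) y.
Proof.
  apply (continuous_RInt_parameter (Z P) (Zu P) b 0 b y (fun _ => s)); auto.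
  apply is_derive_Rconst.
Qed.

Let E (f : R -> R -> R) (s : R) : R := RInt (fun y => f y (s + tau y)) (- q) q.

Let dE (f fs : R -> R -> R) (s : R) :
  (forall y s, is_derive (f y) s (fs y s)) ->
  (forall s y, continuous (fun y => f y (s + tau y)) y) -> jcont fs ->
  is_derive (E f) s (E fs s).
Proof.
  intros Hd Hc Hj. unfold E.
  apply (is_derive_RInt_parameter (fun y s => f y (s + tau y))
           (fun y s => fs y (s + tau y))).
  - intros y s'. apply (is_derive_shift (f y)). auto.
  - exact Hc.
  - now apply jcont_tau.
Qed.

Let dE0 (s : R) : is_derive (E (Psi P)) s (E (Z P) s).
Proof. now apply dE. Qed.

Let dE1 (s : R) : is_derive (E (Z P)) s (E (Zs P) s).
Proof.
  apply dE; auto. intros s' y.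
  apply (cont_y (fun y s => Z P y (s + tau y))). now apply jcont_tau.
Qed.

Let dE2 (s : R) : is_derive (E (Zs P)) s (E (Zss P) s).
Proof.
  apply dE; auto. intros s' y.
  apply (cont_y (fun y s => Zs P y (s + tau y))). now apply jcont_tau.
Qed.

Let E_end (f : R -> R -> R) :
  (forall y s, b <= s -> f y s = 0) -> E f b = 0.
Proof.
  intros Hf. unfold E. apply RInt_zero. rewrite Rmin_left, Rmax_right by lra.
  intros y Hy. apply Hf. pose proof (tau_range y). lra.
Qed.

Let Z_end (y s : R) : b <= s -> Z P y s = 0.
Proof. intros Hs. unfold Z. rewrite tF by (unfold b in Hs; lra). field. lra. Qed.

Let Zs_end (y s : R) : b <= s -> Zs P y s = 0.
Proof.
  intros Hs. unfold Zs. rewrite tF, tFs by (unfold b in Hs; lra). field. lra.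
Qed.

Let Psi_end (y s : R) : b <= s -> Psi P y s = 0.
Proof.
  intros Hs. unfold Psi. apply RInt_zero. rewrite Rmin_left, Rmax_right by lra.
  intros x Hx. apply Z_end. lra.
Qed.

Let quadratic_bound (x y z c m : R) :
  1 <= c -> Rabs x <= m -> Rabs y <= K -> Rabs z <= m ->
  Rabs (x + y * z / c) <= (1 + K) * m.
Proof.
  intros Hc Hx Hy Hz.
  apply Rle_trans with (m + K * m * 1); [| right; ring].
  apply Rabs_plus_le; [easy |]. unfold Rdiv. apply Rabs_mult_le.
  - now apply Rabs_mult_le.
  - rewrite Rabs_pos_eq.
    + rewrite <- Rinv_1. apply Rinv_le_contravar; lra.
    + left. apply Rinv_0_lt_compat. lra.
Qed.

Let Z_bound (y s : R) : Rabs (Z P y s) <= (1 + K) * (M * exp (2 * s)).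
Proof.
  replace (Z P y s) with (F y s + F y s * F y s / (2 * P ^ 2))
    by (unfold Z; field; lra).
  apply quadratic_bound; auto. nra.
Qed.

Let Zs_bound (y s : R) : Rabs (Zs P y s) <= (1 + K) * (M * exp (2 * s)).
Proof. apply quadratic_bound; auto. nra. Qed.

Let exp_shift (a s : R) :
  s <= a + 1 ->
  (1 + K) * (M * exp (2 * s))
  <= (1 + K) * (M * exp 2) * exp (2 * a).
Proof.
  intros Hs. rewrite !Rmult_assoc. apply Rmult_le_compat_l; [lra |].
  apply Rmult_le_compat_l; [easy |]. rewrite <- exp_plus. apply exp_le_compat. lra.
Qed.

Let E2_start (a : R) : Rabs (E (Zs P) a) <= k1 * exp (2 * a).
Proof.
  unfold E.
  replace (k1 * exp (2 * a)) with ((q - - q) * ((1 + K) * (M * exp 2) * exp (2 * a)))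
    by (unfold k1; ring).
  apply abs_RInt_le_const; [lra | |].
  - apply ex_RInt_cont. intros y.
    apply (cont_y (fun y s => Zs P y (s + tau y))). now apply jcont_tau.
  - intros y Hy. eapply Rle_trans; [apply Zs_bound |]. apply exp_shift.
    pose proof (tau_range y Hy). lra.
Qed.

(** Undoing the shear costs only the integral of [Z] over a time at most 1 near [a], which is of
    order [exp (2 * a)]. *)
Let Psi_shift (a : R) :
  Rabs (E (Psi P) a - RInt (fun y => Psi P y a) (- q) q) <= k1 * exp (2 * a).
Proof.
  unfold E.
  rewrite <- RInt_Rminus by auto.
  replace (k1 * exp (2 * a)) with ((q - - q) * ((1 + K) * (M * exp 2) * exp (2 * a)))
    by (unfold k1; ring).
  apply abs_RInt_le_const; [lra | |].
  - apply ex_RInt_cont. intros y.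
    apply (continuous_minus (fun y => Psi P y (a + tau y))); auto.
  - intros y Hy. pose proof (tau_range y Hy) as Ht.
    eapply Rle_trans.
    + apply (increment_abs_le_linear (Psi P y) (Z P y) a (a + tau y)
               ((1 + K) * (M * exp 2) * exp (2 * a))); auto; [lra |].
      intros s Hs. eapply Rle_trans; [apply Z_bound |]. apply exp_shift. lra.
    + pose proof (exp_pos 2). pose proof (exp_pos (2 * a)).
      assert (0 <= (1 + K) * (M * exp 2) * exp (2 * a)).
      { repeat apply Rmult_le_pos; lra. }
      nra.
Qed.

(** The upper bound on [E (Zss P)] is one-sided, but [E (Zs P)] vanishes at [b] and is small at [a]:
    integrating up to [b] bounds it below, integrating from [a] bounds it above. Two more
    integrations from [b] give the factor [(b - a) ^ 2]. With the constant [8], an [a] satisfying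
    [exp (2 * a) <= 1 / P ^ 3] serves both speeds [P] and [2 * P]. *)
Lemma primitive_bound (a : R) :
  a <= b -> exp (2 * a) <= 8 / P ^ 3 ->
  Rabs (RInt (fun y => Psi P y a) (- q) q) <= C2 * (1 + (b - a) ^ 2) / P ^ 3.
Proof.
  intros Hab Ha.
  assert (HP3 : 0 < / P ^ 3) by (apply Rinv_0_lt_compat, pow_lt; lra).
  assert (HC1 : 0 <= C1).
  { unfold C1. pose proof (exp_pos 4).
    repeat apply Rmult_le_pos; lra. }
  assert (Hk1 : 0 <= k1).
  { unfold k1. pose proof (exp_pos 2). repeat apply Rmult_le_pos; lra. }
  assert (HC2 : 0 <= C2).
  { unfold C2. pose proof (exp_pos (2 * b)).
    assert (0 <= C1 * exp (2 * b)) by (apply Rmult_le_pos; lra). lra. }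
  assert (Hka : k1 * exp (2 * a) <= 8 * k1 / P ^ 3).
  { apply Rle_trans with (k1 * (8 / P ^ 3)); [now apply Rmult_le_compat_l |].
    right. field. lra. }
  assert (Hinc : forall s t, s <= t <= b ->
            E (Zs P) t - E (Zs P) s <= C1 * exp (2 * b) / P ^ 3).
  { intros s t Hst.
    set (c := C1 / 2 / P ^ 3).
    assert (Hc : 0 <= c) by (unfold c, Rdiv; apply Rmult_le_pos; [apply Rmult_le_pos |]; lra).
    apply Rle_trans with (c * exp (2 * t) - c * exp (2 * s)).
    - apply (increment_le (E (Zs P)) (fun t => c * exp (2 * t)) (E (Zss P))
               (fun t => C1 * exp (2 * t) / P ^ 3)); auto; [lra | |].
      + intros r _. unfold c. auto_derive; [easy |]. field. lra.
      + intros r _. unfold E.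
        rewrite (RInt_ext (fun y => Zss P y (r + tau y)) (fun y => Zss P y (r + (y + q) / P)))
          by easy.
        now apply crossing.
    - pose proof (exp_pos (2 * s)).
      assert (exp (2 * t) <= exp (2 * b)) by (apply exp_le_compat; lra).
      replace (C1 * exp (2 * b) / P ^ 3) with (2 * c * exp (2 * b)) by (unfold c; field; lra).
      pose proof (exp_pos (2 * b)). nra. }
  assert (H2 : forall s, a <= s <= b -> Rabs (E (Zs P) s) <= C2 / P ^ 3).
  { intros s Hs.
    pose proof (Hinc s b ltac:(lra)) as L1. pose proof (Hinc a s ltac:(lra)) as L2.
    rewrite (E_end (Zs P)) in L1 by auto.
    pose proof (E2_start a) as L3. apply Rabs_le_between in L3.
    assert (0 <= 8 * k1 / P ^ 3) by (unfold Rdiv; apply Rmult_le_pos; lra).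
    replace (C2 / P ^ 3) with (C1 * exp (2 * b) / P ^ 3 + 8 * k1 / P ^ 3)
      by (unfold C2; field; lra).
    apply Rabs_le. lra. }
  assert (HCP : 0 <= C2 / P ^ 3) by (unfold Rdiv; apply Rmult_le_pos; lra).
  assert (H1 : forall s, a <= s <= b -> Rabs (E (Z P) s) <= C2 / P ^ 3 * (b - a)).
  { intros s Hs.
    assert (H : Rabs (E (Z P) b - E (Z P) s) <= C2 / P ^ 3 * (b - s)).
    { apply (increment_abs_le_linear (E (Z P)) (E (Zs P))); auto; [lra |].
      intros r Hr. apply H2. lra. }
    rewrite (E_end (Z P)), Rminus_0_l, Rabs_Ropp in H by auto.
    eapply Rle_trans; [exact H |]. apply Rmult_le_compat_l; lra. }
  assert (H0 : Rabs (E (Psi P) a) <= C2 / P ^ 3 * (b - a) * (b - a)).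
  { assert (H : Rabs (E (Psi P) b - E (Psi P) a) <= C2 / P ^ 3 * (b - a) * (b - a)).
    { apply (increment_abs_le_linear (E (Psi P)) (E (Z P))); auto. }
    rewrite (E_end (Psi P)), Rminus_0_l, Rabs_Ropp in H; auto. }
  pose proof (Psi_shift a) as HS.
  assert (8 * k1 / P ^ 3 <= C2 / P ^ 3).
  { apply Rmult_le_compat_r; [lra |]. unfold C2. pose proof (exp_pos (2 * b)).
    assert (0 <= C1 * exp (2 * b)) by (apply Rmult_le_pos; lra). lra. }
  replace (C2 * (1 + (b - a) ^ 2) / P ^ 3)
    with (C2 / P ^ 3 * (b - a) * (b - a) + C2 / P ^ 3) by (field; lra).
  apply Rabs_le_between in HS. apply Rabs_le_between in H0. apply Rabs_le. lra.
Qed.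

End FixedSpeed.

(** * Comparison of two speeds *)

Let Fsq (y s : R) : R := F y s * F y s.

Let cFsq : jcont Fsq.
Proof. now apply jcont_mult. Qed.

Let cF_s (y s : R) : continuous (F y) s.
Proof. apply (ex_derive_continuous (F y)). eexists. apply dF_s. Qed.

Let cFsq_s (y s : R) : continuous (Fsq y) s.
Proof. apply (continuous_mult (F y) (F y)); auto. Qed.

Let inner (a y : R) : R := RInt (Fsq y) a b.

Let cinner (a y : R) : continuous (inner a) y.
Proof.
  apply (continuous_RInt_parameter Fsq (fun y s => Fu y s * F y s + F y s * Fu y s)
           b 0 a y (fun _ => b)); auto.
  - intros x s. apply (is_derive_Rmult (fun y => F y s) (fun y => F y s)); apply dF_u.
  - apply (jcont_plus (fun y s => Fu y s * F y s)); now apply jcont_mult.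
  - apply is_derive_Rconst.
Qed.

Let inner_nonneg (a y : R) : a <= b -> 0 <= inner a y.
Proof.
  intros H. apply RInt_ge_0; [easy | now apply ex_RInt_cont |].
  intros s _. apply Rle_0_sqr.
Qed.

Let mass (a : R) : R := RInt (inner a) (- q) q.

Let mass_nonneg (a : R) : a <= b -> 0 <= mass a.
Proof.
  intros H. apply RInt_ge_0; [unfold q; lra | now apply ex_RInt_cont |]. auto.
Qed.

Let mass_decreasing (a a' : R) : a' <= a -> a <= b -> mass a <= mass a'.
Proof.
  intros H1 H2. apply RInt_le; try now apply ex_RInt_cont.
  { unfold q. lra. }
  intros y _. unfold inner.
  rewrite <- (RInt_Chasles (Fsq y) a' a b) by now apply ex_RInt_cont.
  assert (0 <= RInt (Fsq y) a' a).
  { apply RInt_ge_0; [easy | now apply ex_RInt_cont |]. intros s _. apply Rle_0_sqr. }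
  unfold plus; simpl. lra.
Qed.

(** [1 / (2 * P ^ 2) - 1 / (8 * P ^ 2) = 3 / (8 * P ^ 2)]; the sign appears because [Psi] integrates
    from [b] to [a]. *)
Let Psi_difference (P a y : R) :
  0 < P -> Psi P y a - Psi (2 * P) y a = - (3 / (8 * P ^ 2)) * inner a y.
Proof.
  intros HP. unfold Psi, inner.
  assert (X : forall P' s, continuous (Z P' y) s).
  { intros P' s. apply (ex_derive_continuous (Z P' y)). unfold Z.
    pose proof (dF_s y s) as H. eexists. derive_poly. }
  rewrite <- RInt_Rminus by auto.
  rewrite (RInt_Rext _ (fun s => 3 / (8 * P ^ 2) * Fsq y s)).
  - rewrite RInt_Rscal by auto.
    rewrite <- (opp_RInt_swap (Fsq y) b a) by now apply ex_RInt_cont.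
    unfold opp; simpl. ring.
  - intros s. unfold Z, Fsq. field. lra.
Qed.

(* Subtracting the bounds for the speeds [P] and [2 P] removes the integral of [F] itself
   and isolates that of [F ^ 2]. *)
Let mass_small (P a : R) :
  1 + 4 * q + 2 * A + 4 * q * A <= P -> a <= b -> exp (2 * a) <= 1 / P ^ 3 ->
  mass a <= 3 * C2 * (1 + (b - a) ^ 2) / P.
Proof.
  intros HP Hab Ha.
  assert (HP1 : 1 <= P).
  { assert (0 < q) by (unfold q; lra).
    assert (0 <= 4 * q * A) by (apply Rmult_le_pos; lra). lra. }
  assert (HP3 : 0 < / P ^ 3) by (apply Rinv_0_lt_compat, pow_lt; lra).
  pose proof (primitive_bound P HP a Hab ltac:(lra)) as B1.
  pose proof (primitive_bound (2 * P) ltac:(lra) a Hab) as B2.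
  replace (8 / (2 * P) ^ 3) with (1 / P ^ 3) in B2 by (field; lra).
  specialize (B2 Ha).
  assert (X : forall P', 1 <= P' -> forall y, continuous (fun y => Psi P' y a) y).
  { intros P' HP' y.
    apply (continuous_RInt_parameter (Z P') (Zu P') b 0 b y (fun _ => a)).
    - intros x s. unfold Z, Zu. pose proof (dF_u x s) as H.
      eapply is_derive_eq; [derive_poly | field; lra].
    - intros x s.
      apply (continuity_2d_pt_ext (fun y s => F y s + F y s * F y s * / (2 * P' ^ 2))).
      + intros. unfold Z. field. lra.
      + apply (jcont_plus F); [easy |].
        apply (jcont_mult Fsq (fun _ _ => / (2 * P' ^ 2))); [easy | apply jcont_const].
    - apply (jcont_plus Fu (fun y s => F y s * Fu y s / P' ^ 2)); [easy |].
      apply (jcont_mult (fun y s => F y s * Fu y s) (fun _ _ => / P' ^ 2));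
        [now apply jcont_mult | apply jcont_const].
    - apply is_derive_Rconst. }
  assert (HD : RInt (fun y => Psi P y a) (- q) q - RInt (fun y => Psi (2 * P) y a) (- q) q
               = - (3 / (8 * P ^ 2)) * mass a).
  { rewrite <- RInt_Rminus by (apply X; lra).
    rewrite (RInt_Rext _ (fun y => - (3 / (8 * P ^ 2)) * inner a y)).
    - now apply RInt_Rscal.
    - intros y. apply Psi_difference. lra. }
  apply Rabs_le_between in B1. apply Rabs_le_between in B2.
  set (c := C2 * (1 + (b - a) ^ 2)) in *.
  replace (c / (2 * P) ^ 3) with (c / P ^ 3 / 8) in B2 by (field; lra).
  (* [9 / 8] is [1 + 1 / 2 ^ 3], one bound for each speed. *)
  assert (H : 3 / (8 * P ^ 2) * mass a <= c / P ^ 3 * (9 / 8)) by lra.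
  apply Rmult_le_reg_l with (3 / (8 * P ^ 2)); [apply Rdiv_lt_0_compat; nra |].
  replace (3 / (8 * P ^ 2) * (3 * C2 * (1 + (b - a) ^ 2) / P)) with (c / P ^ 3 * (9 / 8))
    by (unfold c; field; lra).
  exact H.
Qed.

Let exp_cubic (x : R) : 0 < x -> (x / 3) ^ 3 <= exp x.
Proof.
  intros Hx.
  assert (x / 3 <= exp (x / 3)) by (pose proof (exp_ineq1 (x / 3) ltac:(lra)); lra).
  replace (exp x) with (exp (x / 3) ^ 3).
  - apply pow_incr. lra.
  - simpl. rewrite Rmult_1_r, <- !exp_plus. f_equal. field.
Qed.

(** [mass] only grows when [a] moves left, so it may be estimated at [- 2 * x] with speed [exp x]:
    there [exp (- 4 * x) <= 1 / (exp x) ^ 3], and the bound is quadratic in [x] over [exp x]. *)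
Let mass_zero (a : R) : a <= b -> mass a = 0.
Proof.
  intros Hab. apply Rle_antisym; [| now apply mass_nonneg].
  apply le_epsilon. intros e He. rewrite Rplus_0_l.
  set (P0 := 1 + 4 * q + 2 * A + 4 * q * A).
  (* [81] is [3 * 27], the [27] coming from [(x / 3) ^ 3 <= exp x]; the final bound is [c / x], at
     most [e] once [x >= c / e]. *)
  set (c := 81 * C2 * (1 + (Rabs b + 2) ^ 2)).
  set (x := Rmax 1 (Rmax P0 (Rmax (- a) (Rmax (- b) (c / e))))).
  assert (Hx1 : 1 <= x) by apply Rmax_l.
  assert (Hx2 : Rmax P0 (Rmax (- a) (Rmax (- b) (c / e))) <= x) by apply Rmax_r.
  assert (Hx3 : P0 <= x) by (eapply Rle_trans; [apply Rmax_l | exact Hx2]).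
  assert (Hx4 : Rmax (- a) (Rmax (- b) (c / e)) <= x)
    by (eapply Rle_trans; [apply Rmax_r | exact Hx2]).
  assert (Hx5 : - a <= x) by (eapply Rle_trans; [apply Rmax_l | exact Hx4]).
  assert (Hx6 : Rmax (- b) (c / e) <= x)
    by (eapply Rle_trans; [apply Rmax_r | exact Hx4]).
  assert (Hx7 : - b <= x) by (eapply Rle_trans; [apply Rmax_l | exact Hx6]).
  assert (Hx8 : c / e <= x) by (eapply Rle_trans; [apply Rmax_r | exact Hx6]).
  assert (Hex : x <= exp x) by (pose proof (exp_ineq1 x ltac:(lra)); lra).
  assert (HS : mass (- 2 * x) <= 3 * C2 * (1 + (b - - 2 * x) ^ 2) / exp x).
  { apply mass_small.
    - fold P0. lra.
    - lra.
    - apply Rle_trans with (exp (- (x + x + x))).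
      + apply exp_le_compat. lra.
      + rewrite exp_Ropp, !exp_plus. right. field.
        pose proof (exp_pos x). lra. }
  assert (HC2 : 0 <= C2).
  { unfold C2, C1, k1, q. pose proof (exp_pos 4). pose proof (exp_pos 2).
    pose proof (exp_pos (2 * b)).
    apply Rplus_le_le_0_compat; repeat apply Rmult_le_pos; lra. }
  assert (Hc0 : 0 <= c).
  { unfold c. pose proof (pow2_ge_0 (Rabs b + 2)). repeat apply Rmult_le_pos; lra. }
  apply Rle_trans with (mass (- 2 * x)); [apply mass_decreasing; lra |].
  eapply Rle_trans; [exact HS |].
  assert (Hpoly : 1 + (b - - 2 * x) ^ 2 <= (1 + (Rabs b + 2) ^ 2) * x ^ 2).
  { assert (Hb : Rabs (b - - 2 * x) <= (Rabs b + 2) * x).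
    { pose proof (Rabs_pos b). replace (b - - 2 * x) with (b + 2 * x) by ring.
      eapply Rle_trans; [apply Rabs_triang |]. rewrite (Rabs_pos_eq (2 * x)) by lra. nra. }
    rewrite <- (pow2_abs (b - - 2 * x)).
    assert (Rabs (b - - 2 * x) ^ 2 <= ((Rabs b + 2) * x) ^ 2)
      by (apply pow_incr; split; [apply Rabs_pos | exact Hb]).
    nra. }
  apply Rle_trans with (3 * C2 * ((1 + (Rabs b + 2) ^ 2) * x ^ 2) / (x / 3) ^ 3).
  - pose proof (exp_pos x). apply Rmult_le_compat.
    + apply Rmult_le_pos; [lra |]. pose proof (pow2_ge_0 (b - - 2 * x)). lra.
    + left. now apply Rinv_0_lt_compat.
    + apply Rmult_le_compat_l; lra.
    + apply Rinv_le_contravar; [apply pow_lt; lra | apply exp_cubic; lra].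
  - replace (3 * C2 * ((1 + (Rabs b + 2) ^ 2) * x ^ 2) / (x / 3) ^ 3) with (c / x)
      by (unfold c; field; lra).
    apply Rmult_le_reg_r with x; [lra |].
    unfold Rdiv. rewrite Rmult_assoc, Rinv_l, Rmult_1_r by lra.
    apply Rmult_le_reg_r with (/ e); [now apply Rinv_0_lt_compat |].
    replace (e * x * / e) with x by (field; lra). exact Hx8.
Qed.

Theorem disconjugate_potential_zero (y s : R) : F y s = 0.
Proof.
  destruct (Rlt_le_dec U (Rabs y)) as [Hy | Hy]; [now apply oF |].
  destruct (Rlt_le_dec T s) as [Hs | Hs]; [now apply tF |].
  assert (Hyq : - q < y < q).
  { apply Rabs_le_between in Hy. unfold q. lra. }
  assert (Hin : inner (s - 1) y = 0).
  { apply (RInt_zero_nonneg (fun y => inner (s - 1) y) (- q) q); auto.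
    - intros x. apply inner_nonneg. unfold b. lra.
    - apply mass_zero. unfold b. lra. }
  assert (HF : Fsq y s = 0).
  { apply (RInt_zero_nonneg (Fsq y) (s - 1) b); auto.
    - intros x. apply Rle_0_sqr.
    - unfold b. lra. }
  apply Rsqr_eq_0. exact HF.
Qed.

End FastOrbits.

(** * The potential in logarithmic radius *)

Section Potential.

Context (V : R -> R -> R) (U Rr : R).
Context (V_smooth : smooth3 (radial_lift V)) (U_pos : 0 < U) (Rr_pos : 0 < Rr)
  (V_out : forall u r : R, 0 <= r -> (U <= Rabs u \/ Rr < r) -> V u r = 0).

(* Restriction to the ray [x2 = 0], which for [r >= 0] recovers [V] and its derivatives. *)
Let g (l : list nat) (u r : R) : R := iter_pd l (radial_lift V) u r 0.

Let g_cont (l : list nat) : jcont (g l).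
Proof.
  intros x y. apply continuity_2d_pt_filterlim. intros Q HQ.
  destruct (proj1 (V_smooth l) x y 0 Q HQ) as [e He].
  exists e. intros z [Hz1 Hz2]. apply (He (fst z, (snd z, 0))).
  split; [exact Hz1 | split; [exact Hz2 | apply ball_center]].
Qed.

Let g_du (l : list nat) (u r : R) : is_derive (fun v => g l v r) u (g (0%nat :: l) u r).
Proof.
  apply (Derive_correct (fun v => g l v r)).
  exact (proj2 (V_smooth l) 0%nat ltac:(lia) u r 0).
Qed.

Let g_dr (l : list nat) (u r : R) : is_derive (g l u) r (g (1%nat :: l) u r).
Proof.
  apply (Derive_correct (g l u)).
  exact (proj2 (V_smooth l) 1%nat ltac:(lia) u r 0).
Qed.

(** One function [Fus] has to serve as the [u]-derivative of [Fs] and as the [s]-derivative of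
    [Fu]. *)
Let g_mixed (u r : R) : g (0 :: 1 :: nil)%nat u r = g (1 :: 0 :: nil)%nat u r.
Proof.
  apply (Schwarz (g nil) u r).
  - exists (mkposreal 1 Rlt_0_1). intros x y _ _. split; [| split; [| split]].
    + eexists. apply g_du.
    + eexists. apply g_dr.
    + exists (g (0 :: 1 :: nil)%nat x y). exact (g_du (1%nat :: nil) x y).
    + exists (g (1 :: 0 :: nil)%nat x y). exact (g_dr (0%nat :: nil) x y).
  - exact (g_cont (0 :: 1 :: nil)%nat u r).
  - exact (g_cont (1 :: 0 :: nil)%nat u r).
Qed.

Let lift (h : R -> R -> R) (u s : R) : R := exp (2 * s) * h u (exp s).

Let lift_cont (h : R -> R -> R) : jcont h -> jcont (lift h).
Proof.
  intros Hh. apply (jcont_mult (fun _ s => exp (2 * s)) (fun u s => h u (exp s))).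
  - apply (jcont_comp_1 (fun s => exp (2 * s)) (fun _ s => s)); [| apply jcont_snd].
    intros s. apply (ex_derive_continuous (fun s => exp (2 * s))). auto_derive. easy.
  - apply (jcont_comp h (fun u _ => u) (fun _ s => exp s)); auto using jcont_fst.
    apply (jcont_comp_1 exp (fun _ s => s)); [apply continuous_exp | apply jcont_snd].
Qed.

Let lift_du (h hu : R -> R -> R) (u s : R) :
  (forall u r, is_derive (fun v => h v r) u (hu u r)) ->
  is_derive (fun v => lift h v s) u (lift hu u s).
Proof.
  intros H. apply (is_derive_scal (fun v => h v (exp s))). apply H.
Qed.

(** [d/ds] acts as [r d/dr], plus 2 from the factor [exp (2 * s)]. Derivatives in [s] are therefore
    lifts again and keep the decay [exp (2 * s)]. *)
Let lift_ds (h hr : R -> R -> R) (u s : R) :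
  (forall u r, is_derive (h u) r (hr u r)) ->
  is_derive (lift h u) s (lift (fun u r => 2 * h u r + r * hr u r) u s).
Proof.
  intros H. unfold lift.
  assert (H1 : is_derive (fun s => exp (2 * s)) s (2 * exp (2 * s)))
    by (auto_derive; [easy | ring]).
  assert (H2 : is_derive (fun s => h u (exp s)) s (exp s * hr u (exp s))).
  { apply (is_derive_comp (h u) exp); [apply H | apply is_derive_exp]. }
  eapply is_derive_eq.
  - apply (is_derive_Rmult (fun s => exp (2 * s)) (fun s => h u (exp s))); eassumption.
  - simpl. ring.
Qed.

Let T : R := ln Rr.

(** The unbounded range [s <= T] corresponds to radii in the compact interval [[0, Rr]]; continuity
    up to the origin is what controls [s] near minus infinity. *)
Let lift_bound (h : R -> R -> R) :
  jcont h ->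
  exists M, 0 <= M /\
    forall u s, Rabs u <= U -> s <= T -> Rabs (lift h u s) <= M * exp (2 * s).
Proof.
  intros Hh. destruct (jcont_bounded h (- U) U 0 Rr Hh) as [M [HM0 HM]].
  exists M. split; [easy |]. intros u s Hu Hs. unfold lift.
  rewrite Rmult_comm. apply Rabs_mult_le.
  - apply HM; [now apply Rabs_le_between |].
    split; [left; apply exp_pos |].
    rewrite <- (exp_ln Rr Rr_pos). now apply exp_le_compat.
  - apply Rabs_const_le. left. apply exp_pos.
Qed.

(** Strict inequalities make the region open, so that vanishing passes to derivatives. *)
Let vanishes (X : R -> R -> R) : Prop := forall u s, U < Rabs u \/ T < s -> X u s = 0.

Let vanishes_du (X Y : R -> R -> R) :
  (forall u s, is_derive (fun v => X v s) u (Y u s)) -> vanishes X -> vanishes Y.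
Proof.
  intros HD HX u s H.
  apply (is_derive_locally_zero _ _ _ (HD u s)).
  destruct H as [H | H].
  - apply (filter_imp (fun v => U < Rabs v)); [| now apply locally_Rabs_gt].
    intros v Hv. apply HX. now left.
  - exists (mkposreal 1 Rlt_0_1). intros v _. apply HX. now right.
Qed.

Let vanishes_ds (X Y : R -> R -> R) :
  (forall u s, is_derive (X u) s (Y u s)) -> vanishes X -> vanishes Y.
Proof.
  intros HD HX u s H.
  apply (is_derive_locally_zero _ _ _ (HD u s)).
  destruct H as [H | H].
  - exists (mkposreal 1 Rlt_0_1). intros r _. apply HX. now left.
  - apply (filter_imp (fun r => T < r)); [| now apply locally_gt].
    intros r Hr. apply HX. now right.
Qed.

Let bound_everywhere (X : R -> R -> R) (M M' : R) :
  vanishes X -> 0 <= M <= M' ->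
  (forall u s, Rabs u <= U -> s <= T -> Rabs (X u s) <= M * exp (2 * s)) ->
  (forall u s, Rabs (X u s) <= M' * exp (2 * s)) /\
  (forall u s, Rabs (X u s) <= M' * exp (2 * T)).
Proof.
  intros Hv HM HX.
  assert (H : forall u s, X u s = 0 \/ (s <= T /\ Rabs (X u s) <= M' * exp (2 * s))).
  { intros u s. destruct (Rlt_le_dec U (Rabs u)) as [Hu | Hu]; [left; apply Hv; now left |].
    destruct (Rlt_le_dec T s) as [Hs | Hs]; [left; apply Hv; now right |].
    right. split; [easy |]. eapply Rle_trans; [now apply HX |].
    apply Rmult_le_compat_r; [left; apply exp_pos | lra]. }
  assert (Hpos : forall s, 0 <= M' * exp (2 * s))
    by (intros s; apply Rmult_le_pos; [lra | left; apply exp_pos]).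
  split; intros u s; destruct (H u s) as [-> | [Hs Hb]]; rewrite ?Rabs_R0; auto.
  eapply Rle_trans; [exact Hb |].
  apply Rmult_le_compat_l; [lra |]. apply exp_le_compat. lra.
Qed.

Let g_ray (u s : R) : g nil u (exp s) = Wof V u s.
Proof.
  unfold g, Wof, iter_pd, radial_lift; simpl. f_equal.
  replace (exp s * (exp s * 1) + 0 * (0 * 1)) with ((exp s) ^ 2) by ring.
  apply sqrt_pow2. left. apply exp_pos.
Qed.

Let W_u_eq (u s : R) : W_u (Wof V) u s = g (0 :: nil)%nat u (exp s).
Proof.
  unfold W_u. rewrite (Derive_ext _ (fun v => g nil v (exp s))).
  - apply is_derive_unique, g_du.
  - intros v. now rewrite g_ray.
Qed.

Let W_uu_eq (u s : R) : W_uu (Wof V) u s = g (0 :: 0 :: nil)%nat u (exp s).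
Proof.
  unfold W_uu. rewrite (Derive_ext _ (fun v => g (0 :: nil)%nat v (exp s))).
  - apply is_derive_unique, g_du.
  - intros v. apply W_u_eq.
Qed.

Lemma potential_zero_of_no_conjugate :
  (forall u p, is_solution (Wof V) u p -> ~ has_conjugate_points (Wof V) u) ->
  forall u t, Wof V u t = 0.
Proof.
  intros Hno.
  set (g0 := g nil). set (g1 := g (1 :: nil)%nat).
  set (g2 := g (1 :: 1 :: nil)%nat). set (g3 := g (1 :: 1 :: 1 :: nil)%nat).
  set (gu := g (0 :: nil)%nat). set (guu := g (0 :: 0 :: nil)%nat).
  set (gur := g (1 :: 0 :: nil)%nat).
  assert (D0 : forall u r, is_derive (g0 u) r (g1 u r)) by (intros; apply g_dr).
  assert (D1 : forall u r, is_derive (g1 u) r (g2 u r)) by (intros; apply g_dr).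
  assert (D2 : forall u r, is_derive (g2 u) r (g3 u r)) by (intros; apply g_dr).
  assert (C0 : jcont g0) by apply g_cont. assert (C1 : jcont g1) by apply g_cont.
  assert (C2 : jcont g2) by apply g_cont. assert (C3 : jcont g3) by apply g_cont.
  assert (Cu : jcont gu) by apply g_cont. assert (Cuu : jcont guu) by apply g_cont.
  assert (Cur : jcont gur) by apply g_cont.
  (* [h1], [h2], [h3] lift to [Fs], [Fss], [Fsss], each being [2 h + r h_r] of the preceding one.
     The coefficients 3 and 4 in the [r]-derivatives arise because differentiating [c x + r x']
     gives [(c + 1) x' + r x'']. *)
  set (h1 := fun u r => 2 * g0 u r + r * g1 u r).
  set (h1r := fun u r => 3 * g1 u r + r * g2 u r).
  set (h1rr := fun u r => 4 * g2 u r + r * g3 u r).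
  set (h2 := fun u r => 2 * h1 u r + r * h1r u r).
  set (h2r := fun u r => 3 * h1r u r + r * h1rr u r).
  set (h3 := fun u r => 2 * h2 u r + r * h2r u r).
  set (hur := fun u r => 2 * gu u r + r * gur u r).
  assert (Euler : forall (c : R) (x y z : R -> R -> R),
    (forall u r, is_derive (x u) r (y u r)) -> (forall u r, is_derive (y u) r (z u r)) ->
    forall u r, is_derive (fun r => c * x u r + r * y u r) r
                  ((c + 1) * y u r + r * z u r)).
  { intros c x y z Hx Hy u r. pose proof (Hx u r) as H1. pose proof (Hy u r) as H2.
    pose proof (is_derive_id r : is_derive (fun r => r) r 1) as H3.
    eapply is_derive_eq; [derive_poly | simpl; ring]. }
  assert (Dh1 : forall u r, is_derive (h1 u) r (h1r u r)).
  { intros u r. eapply is_derive_eq; [now apply (Euler 2 g0 g1 g2) |].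
    unfold h1r. ring. }
  assert (Dh1r : forall u r, is_derive (h1r u) r (h1rr u r)).
  { intros u r. eapply is_derive_eq; [now apply (Euler 3 g1 g2 g3) |].
    unfold h1rr. ring. }
  assert (Dh2 : forall u r, is_derive (h2 u) r (h2r u r)).
  { intros u r. eapply is_derive_eq; [now apply (Euler 2 h1 h1r h1rr) |].
    unfold h2r. ring. }
  assert (Ceuler : forall (c : R) x y, jcont x -> jcont y ->
    jcont (fun u r => c * x u r + r * y u r)).
  { intros c x y Hx Hy. apply (jcont_plus (fun u r => c * x u r) (fun u r => r * y u r)).
    - apply (jcont_mult (fun _ _ => c)); [apply jcont_const | easy].
    - apply (jcont_mult (fun _ r => r)); [apply jcont_snd | easy]. }
  assert (Ch1 : jcont h1) by now apply Ceuler.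
  assert (Ch1r : jcont h1r) by now apply Ceuler.
  assert (Ch1rr : jcont h1rr) by now apply Ceuler.
  assert (Ch2 : jcont h2) by now apply Ceuler.
  assert (Ch2r : jcont h2r) by now apply Ceuler.
  assert (Ch3 : jcont h3) by now apply Ceuler.
  assert (Chur : jcont hur) by now apply Ceuler.
  assert (dF_u : forall u s, is_derive (fun v => lift g0 v s) u (lift gu u s))
    by (intros; apply lift_du, g_du).
  assert (dFu_u : forall u s, is_derive (fun v => lift gu v s) u (lift guu u s))
    by (intros; apply lift_du, g_du).
  assert (dFs_u : forall u s, is_derive (fun v => lift h1 v s) u (lift hur u s)).
  { intros u s. apply lift_du. clear u s. intros u r.
    assert (H1 : is_derive (fun v => g0 v r) u (gu u r)) by apply g_du.
    assert (H2 : is_derive (fun v => g1 v r) u (gur u r)).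
    { unfold gur. rewrite <- g_mixed. apply g_du. }
    unfold h1, hur. eapply is_derive_eq; [derive_poly | ring]. }
  assert (dF_s : forall u s, is_derive (lift g0 u) s (lift h1 u s))
    by (intros; now apply (lift_ds g0 g1)).
  assert (dFu_s : forall u s, is_derive (lift gu u) s (lift hur u s)).
  { intros. apply (lift_ds gu gur). intros; apply g_dr. }
  assert (dFs_s : forall u s, is_derive (lift h1 u) s (lift h2 u s))
    by (intros; now apply (lift_ds h1 h1r)).
  assert (dFss_s : forall u s, is_derive (lift h2 u) s (lift h3 u s))
    by (intros; now apply (lift_ds h2 h2r)).
  assert (v0 : vanishes (lift g0)).
  { intros u s H. unfold lift, g0. rewrite g_ray. unfold Wof.
    rewrite V_out; [ring | left; apply exp_pos |].
    destruct H as [H | H]; [left; lra | right].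
    rewrite <- (exp_ln Rr Rr_pos). now apply exp_increasing. }
  assert (vu : vanishes (lift gu)) by exact (vanishes_du _ _ dF_u v0).
  assert (vuu : vanishes (lift guu)) by exact (vanishes_du _ _ dFu_u vu).
  assert (v1 : vanishes (lift h1)) by exact (vanishes_ds _ _ dF_s v0).
  assert (v2 : vanishes (lift h2)) by exact (vanishes_ds _ _ dFs_s v1).
  assert (v3 : vanishes (lift h3)) by exact (vanishes_ds _ _ dFss_s v2).
  destruct (lift_bound g0 C0) as [M0 [P0 B0]].
  destruct (lift_bound gu Cu) as [Mu [Pu Bu]].
  destruct (lift_bound guu Cuu) as [Muu [Puu Buu]].
  destruct (lift_bound h1 Ch1) as [M1 [P1 B1]].
  destruct (lift_bound h2 Ch2) as [M2 [P2 B2]].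
  destruct (lift_bound h3 Ch3) as [M3 [P3 B3]].
  set (M := M0 + Mu + Muu + M1 + M2 + M3).
  destruct (bound_everywhere _ M0 M v0 ltac:(unfold M; lra) B0) as [e0 b0].
  destruct (bound_everywhere _ Mu M vu ltac:(unfold M; lra) Bu) as [_ bu].
  destruct (bound_everywhere _ Muu M vuu ltac:(unfold M; lra) Buu) as [_ buu].
  destruct (bound_everywhere _ M1 M v1 ltac:(unfold M; lra) B1) as [e1 b1].
  destruct (bound_everywhere _ M2 M v2 ltac:(unfold M; lra) B2) as [e2 b2].
  destruct (bound_everywhere _ M3 M v3 ltac:(unfold M; lra) B3) as [e3 _].
  assert (Hzero : forall u s, lift g0 u s = 0).
  { apply (disconjugate_potential_zero (lift g0) (lift gu) (lift guu) (lift h1) (lift hur)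
             (lift h2) (lift h3) M (M * exp (2 * T)) U T);
      auto using lift_cont.
    intros u p Hup xi dxi HJ t1 t2 Ht z1 z2 t.
    destruct (Req_dec (xi t) 0) as [| Hxi]; [easy | exfalso].
    apply (Hno u p).
    - intros s. destruct (Hup s) as [H1 H2]. split; [exact H1 |].
      rewrite W_u_eq. exact H2.
    - exists t1, t2, xi, dxi. split; [easy |]. split; [now exists t |].
      split; [| easy]. intros s. destruct (HJ s) as [H1 H2]. split; [exact H1 |].
      rewrite W_uu_eq. exact H2. }
  intros u t. specialize (Hzero u t). unfold lift, g0 in Hzero. rewrite g_ray in Hzero.
  apply Rmult_integral in Hzero. pose proof (exp_pos (2 * t)).
  destruct Hzero; [lra | easy].
Qed.

End Potential.

Theorem theorem4 (V : R -> R -> R) (U Rr : R) :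
  smooth3 (radial_lift V) ->
  0 < U -> 0 < Rr ->
  (forall u r : R, 0 <= r -> (U <= Rabs u \/ Rr < r) -> V u r = 0) ->
  ~ (forall u t : R, Wof V u t = 0) ->
  exists u p : R -> R,
    is_solution (Wof V) u p /\ has_conjugate_points (Wof V) u.
Proof.
  intros HV HU HR Hout Hnz. apply NNPP. intros Hno. apply Hnz.
  apply (potential_zero_of_no_conjugate V U Rr); auto.
  intros u p Hs Hc. apply Hno. now exists u, p.
Qed.
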